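(* Let $\mathfrak A$ be a Banach algebra with the following properties: (i) Every bounded linear map from $\mathfrak A$ to $\mathfrak A^\ast$ is weakly compact. (ii) $\mathfrak A^{\ast\ast}$ is strongly Connes-amenable. Then $\mathfrak A$ is amenable.
   Context: A Banach algebra $\mathfrak B$ is called dual if there is a closed submodule $\mathfrak B_\ast$ of the Banach $\mathfrak B$-bimodule $\mathfrak B^\ast$ such that $\mathfrak B = (\mathfrak B_\ast)^\ast$; the $w^\ast$-topology on $\mathfrak B$ is $\sigma(\mathfrak B,\mathfrak B_\ast)$. Condition (i) implies that $\mathfrak A$ is Arens regular (the two Arens products on $\mathfrak A^{\ast\ast}$ coincide), so that $\mathfrak A^{\ast\ast}$ is a dual Banach algebra with predual $\mathfrak A^\ast$. A derivation from a Banach algebra $\mathfrak A$ into a Banach $\mathfrak A$-bimodule $E$ is a bounded linear map $D$ with $D(ab) = a\cdot Db + (Da)\cdot b$; it is inner if it is of the form $a \mapsto a\cdot x - x\cdot a$ for some $x \in E$. The dual $E^\ast$ of a Banach $\mathfrak A$-bimodule is a Banach $\mathfrak A$-bimodule via $\langle x, a\cdot\phi\rangle = \langle x\cdot a,\phi\rangle$, $\langle x,\phi\cdot a\rangle = \langle a\cdot x,\phi\rangle$. $\mathfrak A$ is amenable if, for every Banach $\mathfrak A$-bimodule $E$, every derivation $\mathfrak A \to E^\ast$ is inner. Let $\mathfrak B$ be a dual Banach algebra and $E$ a Banach $\mathfrak B$-bimodule. An element $\phi\in E^\ast$ is a $w^\ast$-element if the maps $\mathfrak B\to E^\ast$, $b\mapsto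 b\cdot\phi$ and $b\mapsto \phi\cdot b$, are $w^\ast$-continuous ($\sigma(\mathfrak B,\mathfrak B_\ast)$-$\sigma(E^\ast,E)$). A dual Banach algebra $\mathfrak B$ with identity is strongly Connes-amenable if, for each unital Banach $\mathfrak B$-bimodule $E$, every $w^\ast$-continuous derivation $D\colon\mathfrak B\to E^\ast$ whose range consists of $w^\ast$-elements is inner. (Being strongly Connes-amenable includes having an identity.) *)

(* Defs.v *)
From HB Require Import structures.
From mathcomp Require Import all_boot all_order all_algebra.
From mathcomp Require Import complex.
From mathcomp Require Import boolp classical_sets functions reals.
From mathcomp Require Import topology normedtype.

Set Implicit Arguments.
Unset Strict Implicit.
Unset Printing Implicit Defensive.

Import Order.TTheory GRing.Theory Num.Theory.
Import numFieldNormedType.Exports.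

Local Open Scope classical_set_scope.
Local Open Scope ring_scope.

(* Not necessarily unital, hence not built on the ring structures of
   MathComp, whose multiplication always has a neutral element. *)
HB.mixin Record isBanachAlgebra (K : numFieldType) A
    & CompleteNormedModule K A := {
  bmul : A -> A -> A;
  bmulA : forall a b c, bmul a (bmul b c) = bmul (bmul a b) c;
  bmulDl : forall a b c, bmul (a + b) c = bmul a c + bmul b c;
  bmulDr : forall a b c, bmul a (b + c) = bmul a b + bmul a c;
  bmulZl : forall (k : K) a b, bmul (k *: a) b = k *: bmul a b;
  bmulZr : forall (k : K) a b, bmul a (k *: b) = k *: bmul a b;
  bmul_norm : forall a b, `|bmul a b| <= `|a| * `|b|
}.

#[short(type="banachAlgType")]
HB.structure Definition BanachAlgebra (K : numFieldType) :=
  {A of CompleteNormedModule K A & isBanachAlgebra K A}.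

HB.mixin Record isBanachBimodule (K : numFieldType) (A : banachAlgType K) E
    & CompleteNormedModule K E := {
  lact : A -> E -> E;
  ract : E -> A -> E;
  lactDl : forall a b x, lact (a + b) x = lact a x + lact b x;
  lactDr : forall a x y, lact a (x + y) = lact a x + lact a y;
  lactZl : forall (k : K) a x, lact (k *: a) x = k *: lact a x;
  lactZr : forall (k : K) a x, lact a (k *: x) = k *: lact a x;
  ractDl : forall x y a, ract (x + y) a = ract x a + ract y a;
  ractDr : forall x a b, ract x (a + b) = ract x a + ract x b;
  ractZl : forall (k : K) x a, ract (k *: x) a = k *: ract x a;
  ractZr : forall (k : K) x a, ract x (k *: a) = k *: ract x a;
  lactM : forall a b x, lact (bmul a b) x = lact a (lact b x);
  ractM : forall x a b, ract x (bmul a b) = ract (ract x a) b;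
  lractA : forall a x b, lact a (ract x b) = ract (lact a x) b;
  lact_bounded : exists M : K, forall a x, `|lact a x| <= M * `|a| * `|x|;
  ract_bounded : exists M : K, forall x a, `|ract x a| <= M * `|x| * `|a|
}.

#[short(type="banachBimodType")]
HB.structure Definition BanachBimodule (K : numFieldType)
    (A : banachAlgType K) :=
  {E of CompleteNormedModule K E & isBanachBimodule K A E}.

Definition bounded_linear (K : numFieldType) (E F : normedModType K)
    (T : E -> F) : Prop :=
  linear T /\ exists M : K, forall x, `|T x| <= M * `|x|.

Lemma ler_absM (K : numDomainType) (t M s : K) :
  0 <= t -> 0 <= s -> t <= M * s -> t <= `|M| * s.
Proof.
move=> t0; rewrite le_eqVlt => /predU1P[<-|s0 tMs]; first by rewrite !mulr0.
apply: (le_trans tMs); apply: ler_wpM2r; first exact: ltW.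
apply: real_ler_norm.
by have := le_trans t0 tMs; rewrite pmulr_lge0// => /ger0_real.
Qed.

Section Dual.
Variables (R : realType).
Local Notation K := R[i].
Local Open Scope complex_scope.

Section DualSpace.
Variable E : normedModType K.

Definition dual_pred : {pred E -> K^o} :=
  [pred f | `[< bounded_linear (f : E -> K^o) >]].

Lemma ge0_bound (V W : normedModType K) (T : V -> W) :
  (exists M : K, forall x, `|T x| <= M * `|x|) ->
  exists2 M : K, 0 <= M & forall x, `|T x| <= M * `|x|.
Proof.
by move=> [M HM]; exists `|M| => // x; rewrite ler_absM.
Qed.

Lemma dual_pred_submod : submod_closed dual_pred.
Proof.
split.
  apply/asboolP; split; first by move=> k x y /=; rewrite scaler0 addr0.
  by exists 0 => x; rewrite mul0r normr0.
move=> k f g /asboolP[lf /ge0_bound[M M0 HM]] /asboolP[lg /ge0_bound[N N0 HN]].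
apply/asboolP; split.
  move=> c x y; rewrite /GRing.add/= /GRing.scale/= lf lg.
  by rewrite /GRing.scale/= !mulrDr mulrCA addrACA.
exists (`|k| * M + N) => x.
apply: le_trans (ler_normD _ _) _.
rewrite mulrDl lerD// normrZ -mulrA ler_wpM2l//.
Qed.

HB.instance Definition _ :=
  GRing.isSubmodClosed.Build K (E -> K^o) dual_pred dual_pred_submod.

Record dual : Type := Dual { dual_fun :> E -> K^o; _ : dual_fun \in dual_pred }.

HB.instance Definition _ := [isSub for dual_fun].
HB.instance Definition _ := [Choice of dual by <:].
HB.instance Definition _ := [SubChoice_isSubLmodule of dual by <:].


Lemma dual_bounded_linear (f : dual) : bounded_linear (f : E -> K^o).
Proof. by case: f => f /= /asboolP. Qed.

HB.instance Definition _ (f : dual) :=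
  GRing.isLinear.Build K E K^o _ (dual_fun f) (dual_bounded_linear f).1.

Lemma dualP (f g : dual) : (forall x, f x = g x) -> f = g.
Proof. by move=> fg; apply/val_inj/funext. Qed.

Lemma dual_add (f g : dual) x : (f + g) x = f x + g x. Proof. by []. Qed.
Lemma dual_opp (f : dual) x : (- f) x = - f x. Proof. by []. Qed.
Lemma dual_scale (k : K) (f : dual) x : (k *: f) x = k * f x.
Proof. by []. Qed.

(* Norms take their values in the complex field, hence the detour through
   the real part and the embedding `%:C`. *)
Definition dual_values (f : dual) : set R :=
  [set r : R | exists2 x : E, `|x| <= 1 & r = complex.Re `|f x|].

Definition dual_norm (f : dual) : K := (sup (dual_values f))%:C.

Lemma ReK_ge0 (z : K) : 0 <= z -> (complex.Re z)%:C = z.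
Proof. by move=> /ger0_real /RRe_real. Qed.

Lemma dual_has_sup (f : dual) : has_sup (dual_values f).
Proof.
split; first by exists 0; exists 0; rewrite ?normr0// linear0 normr0.
have [M M0 HM] := ge0_bound (dual_bounded_linear f).2.
exists (complex.Re M) => _ [x x1 ->].
rewrite -lecR !ReK_ge0 //; apply: le_trans (HM x) _.
by rewrite ler_piMr.
Qed.

Lemma dual_norm_ge0 (f : dual) : 0 <= dual_norm f.
Proof.
rewrite -[0]/(0%:C) lecR; apply: sup_upper_bound; first exact: dual_has_sup.
by exists 0; rewrite ?normr0// linear0 normr0.
Qed.

Lemma dual_normP (f : dual) (x : E) : `|f x| <= dual_norm f * `|x|.
Proof.
have [->|x0] := eqVneq x 0; first by rewrite linear0 !normr0 mulr0.
have nx0 : 0 < `|x| by rewrite normr_gt0.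
have : `|f (`|x|^-1 *: x)| <= dual_norm f.
  rewrite -(ReK_ge0 (normr_ge0 (f _))) lecR; apply: sup_upper_bound.
    exact: dual_has_sup.
  exists (`|x|^-1 *: x) => //.
  by rewrite normrZ normfV normr_id mulVf ?gt_eqF.
by rewrite linearZ normrZ normfV normr_id mulrC ler_pdivrMr.
Qed.

Lemma dual_norm_le (f : dual) (M : K) :
  0 <= M -> (forall x, `|f x| <= M * `|x|) -> dual_norm f <= M.
Proof.
move=> M0 HM; rewrite -(ReK_ge0 M0) lecR; apply: ge_sup.
  by case: (dual_has_sup f).
move=> _ [x x1 ->]; rewrite -lecR !ReK_ge0//.
by apply: le_trans (HM x) _; rewrite ler_piMr.
Qed.

Lemma dual_norm_triangle (f g : dual) :
  dual_norm (f + g) <= dual_norm f + dual_norm g.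
Proof.
apply: dual_norm_le => [|x]; first by rewrite addr_ge0 ?dual_norm_ge0.
by rewrite dual_add mulrDl (le_trans (ler_normD _ _))// lerD// dual_normP.
Qed.

Lemma dual_norm_scale_le (k : K) (f : dual) :
  dual_norm (k *: f) <= `|k| * dual_norm f.
Proof.
apply: dual_norm_le => [|x]; first by rewrite mulr_ge0 ?dual_norm_ge0.
by rewrite dual_scale normrM -mulrA ler_wpM2l ?dual_normP.
Qed.

Lemma dual_norm_scale (k : K) (f : dual) :
  dual_norm (k *: f) = `|k| * dual_norm f.
Proof.
apply/le_anti; rewrite dual_norm_scale_le /=.
have [->|k0] := eqVneq k 0; first by rewrite normr0 mul0r dual_norm_ge0.
rewrite -ler_pdivlMl ?normr_gt0// -normfV.
by apply: le_trans (dual_norm_scale_le _ _); rewrite scalerA mulVf// scale1r.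
Qed.

Lemma dual_norm_eq0 (f : dual) : dual_norm f = 0 -> f = 0.
Proof.
move=> f0; apply: dualP => x; apply/eqP.
by rewrite -normr_le0 (le_trans (dual_normP f x))// f0 mul0r.
Qed.

HB.instance Definition _ := Lmodule_isNormed.Build K dual
  dual_norm_triangle dual_norm_scale dual_norm_eq0.

Lemma dual_normE (f : dual) : `|f| = dual_norm f. Proof. by []. Qed.

Lemma ler_dual (f : dual) (x : E) : `|f x| <= `|f| * `|x|.
Proof. exact: dual_normP. Qed.

End DualSpace.

Lemma complex_complete (F : set_system K^o) :
  ProperFilter F -> cauchy F -> cvg F.
Proof.
move=> FF /cauchy_ballP cF; apply/cvg_ex.
have cauchyP (h : K -> R) : (forall x y, `|h x - h y|%:C <= `|x - y|) ->
    exists l : R, h @ F --> l.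
  move=> hP; apply/cvg_ex; apply: cauchy_cvg; apply/cauchy_ballP => e e0.
  have e0' : 0 < e%:C :> K by rewrite -[0]/(0%:C) ltcR.
  have := cF _ e0'; rewrite /prop_near1 /nbhs /=.
  case=> -[A B] /= [FA FB] AB; exists (h @` A, h @` B) => /=.
    by split; [apply: filterS FA => x Ax|apply: filterS FB => x Ax]; exists x.
  move=> [_ _] /= [[x Ax <-] [y By <-]]; rewrite /ball /= -ltcR.
  by apply: le_lt_trans (hP _ _) _; apply: (AB (x, y)).
have [a Fa] : exists l : R, @complex.Re R @ F --> l.
  by apply: cauchyP => x y; rewrite -raddfB; exact: normc_ge_Re.
have [b Fb] : exists l : R, @complex.Im R @ F --> l.
  apply: cauchyP => x y; rewrite -raddfB.
  case: (x - y) => u v /=; rewrite normc_def lecR /= -sqrtr_sqr ler_wsqrtr//.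
  by rewrite lerDr sqr_ge0.
exists (a +i* b); apply/(@fcvgrPdist_lt _ K^o) => e e0.
have e2 : 0 < complex.Re e / 2.
  by rewrite divr_gt0// -ltcR ReK_ge0 ?ltW.
near=> z.
have az : `|a - complex.Re z| < complex.Re e / 2.
  by near: z; exact: cvgr_dist_lt Fa _ e2.
have bz : `|b - complex.Im z| < complex.Re e / 2.
  by near: z; exact: cvgr_dist_lt Fb _ e2.
move: az bz; case: (z) => u v /= az bz.
rewrite (_ : _ - _ = (a - u)%:C + 'i * (b - v)%:C); last by simpc.
apply: le_lt_trans (ler_normD _ _) _.
have -> : e = (complex.Re e / 2)%:C + (complex.Re e / 2)%:C.
  by rewrite -rmorphD -splitr; apply/esym/ReK_ge0/ltW.
apply: ltrD.
  by rewrite normc_def /= expr0n addr0 sqrtr_sqr ltcR.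
rewrite normrM [`|'i|]normc_def /= !expr0n expr1n add0r sqrtr1 mul1r.
by rewrite normc_def /= expr0n addr0 sqrtr_sqr ltcR.
Unshelve. all: by end_near. Qed.

Section DualComplete.
Variable E : normedModType K.
Local Notation dual := (dual E).

Lemma dual_complete (F : set_system dual) : ProperFilter F -> cauchy F -> cvg F.
Proof.
move=> FF /cauchy_ballP cF; apply/cvg_ex.
have cvx (x : E) : exists l : K^o, (fun f : dual => f x : K^o) @ F --> l.
  apply/cvg_ex; apply: complex_complete; apply/cauchy_ballP => e e0.
  have x1 : 0 < `|x| + 1 by rewrite ltr_wpDl.
  have e0' : 0 < e / (`|x| + 1) by rewrite divr_gt0.
  have := cF _ e0'; rewrite /prop_near1 /nbhs /=.
  case=> -[A B] /= [FA FB] AB.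
  exists ((fun f : dual => f x) @` A, (fun f : dual => f x) @` B) => /=.
    by split; [apply: filterS FA => f Af|apply: filterS FB => f Af]; exists f.
  move=> [_ _] /= [[f Af <-] [g Bg <-]]; rewrite /ball /=.
  have := AB (f, g) (conj Af Bg); rewrite -ball_normE /= => fg.
  rewrite -dual_opp -dual_add (le_lt_trans (ler_dual _ _))//.
  apply: le_lt_trans (_ : `|f - g| * (`|x| + 1) < _).
    by rewrite ler_wpM2l// lerDl.
  by rewrite -ltr_pdivlMr.
pose g x := projT1 (cid (cvx x)).
have gP x : (fun f : dual => f x : K^o) @ F --> g x := projT2 (cid (cvx x)).
have est (e : K) : 0 < e ->
    F [set f : dual | forall x, `|f x - g x| <= e * `|x|].
  have FF' : Filter F := @filter_filter _ F FF.
  move=> e0; have := @nearP_dep _ _ F F FF' FF' _ (cF _ e0).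
  apply: (@filterS _ F FF') => f fh x.
  apply/ler_addgt0Pr => d d0.
  have /filter_ex[h [hf hg]] : F [set h : dual |
      ball f e h /\ `|g x - h x| < d].
    apply: filterI => //.
    exact: (@cvgr_dist_lt K K^o _ _ _ (fun f : dual => f x) (g x) (gP x) d d0).
  rewrite -(subrKA (h x)) (le_trans (ler_normD _ _))// lerD//; last first.
    by rewrite distrC ltW.
  rewrite -dual_opp -dual_add (le_trans (ler_dual _ _))//.
  by rewrite ler_wpM2r// ltW//; move: hf; rewrite -ball_normE.
have glin : linear (g : E -> K^o).
  move=> k x y; apply: (cvg_unique (@norm_hausdorff _ _) (gP _)).
  rewrite (_ : (fun f : dual => _) =
    (fun f : dual => k *: (f x : K^o) + f y)); last first.
    by apply/funext => f; exact: (dual_bounded_linear f).1.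
  apply: (@cvgD K K^o _ F (@filter_filter _ F FF)); last exact: gP.
  by apply: (@cvgZr K K^o _ F (@filter_filter _ F FF)); exact: gP.
have gdual : g \in @dual_pred E.
  apply/asboolP; split => //.
  have /filter_ex[f fP] := est 1 ltr01.
  exists (`|f| + 1) => x; rewrite -(subKr (f x) (g x)) mulrDl.
  by rewrite (le_trans (ler_normB _ _))// lerD// ler_dual.
exists (Dual gdual); apply/fcvgrPdist_lt => e e0.
have e20 : 0 < e / 2 by rewrite divr_gt0.
apply: filterS (est _ e20) => f fP.
rewrite distrC (@le_lt_trans _ _ (e / 2))//; last first.
  by rewrite ltr_pdivrMr// ltr_pMr// ltr1n.
by apply: dual_norm_le; [exact: ltW|exact: fP].
Qed.

HB.instance Definition _ := Uniform_isComplete.Build dual dual_complete.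

End DualComplete.

(* The weak topology on X given by the functionals [pairing^~ y], y : Y, i.e.
   the initial topology for X -> K^Y. *)
Definition sigma (X Y : Type) (pairing : X -> Y -> K^o) : Type :=
  initial_topology (pairing : X -> {ptws Y -> K^o}).

HB.instance Definition _ (X : choiceType) (Y : Type) (p : X -> Y -> K^o) :=
  Topological.on (sigma p).

Lemma mk_dual_subproof (E : normedModType K) (f : E -> K^o) :
  bounded_linear f -> f \in @dual_pred E.
Proof. by move=> ?; apply/asboolP. Qed.

Definition mk_dual (E : normedModType K) (f : E -> K^o)
  (fP : bounded_linear f) : dual E := Dual (mk_dual_subproof fP).

Lemma dual_lin (E : normedModType K) (f : dual E) k x y :
  f (k *: x + y) = k * f x + f y.
Proof. exact: (dual_bounded_linear f).1. Qed.

Section DualBimodule.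
Variables (A : banachAlgType K) (E : banachBimodType A).

Lemma dual_lact_subproof (a : A) (phi : dual E) :
  bounded_linear (fun x : E => phi (ract x a) : K^o).
Proof.
split; first by move=> k x y; rewrite ractDl ractZl dual_lin.
have [M HM] := @ract_bounded _ _ E.
exists (`|phi| * `|M| * `|a|) => x.
rewrite (le_trans (ler_dual _ _))// -!mulrA ler_wpM2l//.
by rewrite [X in _ * X]mulrC ler_absM ?mulr_ge0// mulrA HM.
Qed.

Definition dual_lact a phi : dual E := mk_dual (dual_lact_subproof a phi).

Lemma dual_ract_subproof (phi : dual E) (a : A) :
  bounded_linear (fun x : E => phi (lact a x) : K^o).
Proof.
split; first by move=> k x y; rewrite lactDr lactZr dual_lin.
have [M HM] := @lact_bounded _ _ E.
exists (`|phi| * `|M| * `|a|) => x.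
rewrite (le_trans (ler_dual _ _))// -!mulrA ler_wpM2l//.
by rewrite ler_absM ?mulr_ge0// mulrA HM.
Qed.

Definition dual_ract phi a : dual E := mk_dual (dual_ract_subproof phi a).

Let lDl a b phi : dual_lact (a + b) phi = dual_lact a phi + dual_lact b phi.
Proof. by apply: dualP => x; rewrite dual_add /= ractDr linearD. Qed.

Let lDr a phi psi : dual_lact a (phi + psi) = dual_lact a phi + dual_lact a psi.
Proof. exact: dualP. Qed.

Let lZl (k : K) a phi : dual_lact (k *: a) phi = k *: dual_lact a phi.
Proof. by apply: dualP => x; rewrite dual_scale /= ractZr linearZ. Qed.

Let lZr (k : K) a phi : dual_lact a (k *: phi) = k *: dual_lact a phi.
Proof. exact: dualP. Qed.

Let rDl phi psi a : dual_ract (phi + psi) a = dual_ract phi a + dual_ract psi a.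
Proof. exact: dualP. Qed.

Let rDr phi a b : dual_ract phi (a + b) = dual_ract phi a + dual_ract phi b.
Proof. by apply: dualP => x; rewrite dual_add /= lactDl linearD. Qed.

Let rZl (k : K) phi a : dual_ract (k *: phi) a = k *: dual_ract phi a.
Proof. exact: dualP. Qed.

Let rZr (k : K) phi a : dual_ract phi (k *: a) = k *: dual_ract phi a.
Proof. by apply: dualP => x; rewrite dual_scale /= lactZl linearZ. Qed.

Let lM a b phi : dual_lact (bmul a b) phi = dual_lact a (dual_lact b phi).
Proof. by apply: dualP => x /=; rewrite ractM. Qed.

Let rM phi a b : dual_ract phi (bmul a b) = dual_ract (dual_ract phi a) b.
Proof. by apply: dualP => x /=; rewrite lactM. Qed.

Let lrA a phi b : dual_lact a (dual_ract phi b) = dual_ract (dual_lact a phi) b.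
Proof. by apply: dualP => x /=; rewrite lractA. Qed.

Let lb : exists M : K, forall a phi, `|dual_lact a phi| <= M * `|a| * `|phi|.
Proof.
have [M HM] := @ract_bounded _ _ E.
exists `|M| => a phi; apply: dual_norm_le; first by rewrite !mulr_ge0.
move=> x; rewrite (le_trans (ler_dual phi (ract x a)))//.
rewrite mulrAC [leRHS]mulrC ler_wpM2l//.
by rewrite -mulrA [X in _ * X]mulrC ler_absM ?mulr_ge0// mulrA HM.
Qed.

Let rb : exists M : K, forall phi a, `|dual_ract phi a| <= M * `|phi| * `|a|.
Proof.
have [M HM] := @lact_bounded _ _ E.
exists `|M| => phi a; apply: dual_norm_le; first by rewrite !mulr_ge0.
move=> x; rewrite (le_trans (ler_dual phi (lact a x)))//.
rewrite [_ * `|phi|]mulrC -!mulrA.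
by rewrite ler_wpM2l// ler_absM ?mulr_ge0// mulrA HM.
Qed.

HB.instance Definition _ := isBanachBimodule.Build K A (dual E)
  lDl lDr lZl lZr rDl rDr rZl rZr lM rM lrA lb rb.

End DualBimodule.

Section ArensProduct.
Variable A : banachAlgType K.

Lemma arens1_subproof (f : dual A) (a : A) :
  bounded_linear (fun b : A => f (bmul a b) : K^o).
Proof.
split; first by move=> k x y; rewrite bmulDr bmulZr dual_lin.
exists (`|f| * `|a|) => b; rewrite (le_trans (ler_dual _ _))//.
by rewrite -mulrA ler_wpM2l// bmul_norm.
Qed.

(* First Arens product:
     <Phi Psi, f> = <Phi, Psi.f>,  <Psi.f, a> = <Psi, f.a>,  <f.a, b> = <f, ab>,
   where f.a is [arens1 f a] and Psi.f is [arens2 Psi f].  It coincides with the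
   second Arens product when A is Arens regular. *)
Definition arens1 (f : dual A) (a : A) : dual A :=
  mk_dual (arens1_subproof f a).

Lemma arens1_norm f a : `|arens1 f a| <= `|f| * `|a|.
Proof.
apply: dual_norm_le => [|b]; first by rewrite mulr_ge0.
rewrite (le_trans (ler_dual f (bmul a b)))//.
by rewrite -mulrA ler_wpM2l// bmul_norm.
Qed.

Lemma arens2_subproof (Psi : dual (dual A)) (f : dual A) :
  bounded_linear (fun a : A => Psi (arens1 f a) : K^o).
Proof.
split=> [k x y|].
  rewrite -[RHS]dual_lin; congr (Psi _); apply: dualP => b.
  by rewrite dual_add dual_scale /= bmulDl bmulZl dual_lin.
exists (`|Psi| * `|f|) => a; rewrite (le_trans (ler_dual _ _))//.
by rewrite -mulrA ler_wpM2l// arens1_norm.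
Qed.

Definition arens2 (Psi : dual (dual A)) (f : dual A) : dual A :=
  mk_dual (arens2_subproof Psi f).

Lemma arens2_norm Psi f : `|arens2 Psi f| <= `|Psi| * `|f|.
Proof.
apply: dual_norm_le => [|a]; first by rewrite mulr_ge0.
rewrite (le_trans (ler_dual Psi (arens1 f a)))//.
by rewrite -mulrA ler_wpM2l// arens1_norm.
Qed.

Lemma arens_subproof (Phi Psi : dual (dual A)) :
  bounded_linear (fun f : dual A => Phi (arens2 Psi f) : K^o).
Proof.
split=> [k x y|].
  rewrite -[RHS]dual_lin; congr (Phi _); apply: dualP => a.
  rewrite dual_add dual_scale /= -dual_lin; congr (Psi _).
  exact: dualP.
exists (`|Phi| * `|Psi|) => f; rewrite (le_trans (ler_dual _ _))//.
by rewrite -mulrA ler_wpM2l// arens2_norm.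
Qed.

Definition arens (Phi Psi : dual (dual A)) : dual (dual A) :=
  mk_dual (arens_subproof Phi Psi).

Let arensA Phi Psi Chi : arens Phi (arens Psi Chi) = arens (arens Phi Psi) Chi.
Proof.
apply: dualP => f /=; congr (Phi _); apply: dualP => a /=.
congr (Psi _); apply: dualP => b /=; congr (Chi _); apply: dualP => c /=.
by rewrite bmulA.
Qed.

Let arensDl Phi Psi Chi : arens (Phi + Psi) Chi = arens Phi Chi + arens Psi Chi.
Proof. exact: dualP. Qed.

Let arensDr Phi Psi Chi : arens Phi (Psi + Chi) = arens Phi Psi + arens Phi Chi.
Proof.
apply: dualP => f; rewrite dual_add /= -linearD; congr (Phi _).
exact: dualP.
Qed.

Let arensZl (k : K) Phi Psi : arens (k *: Phi) Psi = k *: arens Phi Psi.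
Proof. exact: dualP. Qed.

Let arensZr (k : K) Phi Psi : arens Phi (k *: Psi) = k *: arens Phi Psi.
Proof.
apply: dualP => f; rewrite dual_scale /=.
transitivity (Phi (k *: arens2 Psi f)); last by rewrite linearZ.
by congr (Phi _); exact: dualP.
Qed.

Let arens_norm Phi Psi : `|arens Phi Psi| <= `|Phi| * `|Psi|.
Proof.
apply: dual_norm_le => [|f]; first by rewrite mulr_ge0.
rewrite (le_trans (ler_dual Phi (arens2 Psi f)))//.
by rewrite -mulrA ler_wpM2l// arens2_norm.
Qed.

HB.instance Definition _ := isBanachAlgebra.Build K (dual (dual A))
  arensA arensDl arensDr arensZl arensZr arens_norm.

End ArensProduct.

Section CanonicalEmbedding.
Variable E : normedModType K.

Lemma evaluation_subproof (x : E) :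
  bounded_linear (fun f : dual E => f x : K^o).
Proof. by split=> //; exists `|x| => f; rewrite mulrC ler_dual. Qed.

Definition evaluation (x : E) : dual (dual E) :=
  mk_dual (evaluation_subproof x).

End CanonicalEmbedding.

Definition weak (E : normedModType K) : Type :=
  sigma (fun (x : E) (f : dual E) => f x).
HB.instance Definition _ (E : normedModType K) := Topological.on (weak E).

Definition weakstar (E : normedModType K) : Type :=
  sigma (fun (f : dual E) (x : E) => f x).
HB.instance Definition _ (E : normedModType K) := Topological.on (weakstar E).

Definition weakly_compact (E F : normedModType K) (T : E -> F) : Prop :=
  precompact (T @` [set x | `|x| <= 1] : set (weak F)).

Section Amenability.
Variable A : banachAlgType K.

Definition derivation (E : banachBimodType A) (D : A -> E) : Prop :=
  bounded_linear D /\
  forall a b, D (bmul a b) = lact a (D b) + ract (D a) b.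

Definition inner (E : banachBimodType A) (D : A -> E) : Prop :=
  exists x : E, forall a, D a = lact a x - ract x a.

Definition amenable : Prop :=
  forall (E : banachBimodType A) (D : A -> dual E), derivation D -> inner D.

End Amenability.

Section ConnesAmenability.
Variables (B : banachAlgType K) (P : set (dual B)).

(* sigma(B, P), where P plays the part of the predual B_* inside B^* *)
Definition predual_topology : Type :=
  sigma (fun (b : B) (f : set_type P) => (val f : dual B) b).
HB.instance Definition _ := Topological.on predual_topology.

Definition wstar_continuous (E : normedModType K) (T : B -> dual E) : Prop :=
  continuous (T : predual_topology -> weakstar E).

Definition wstar_element (E : banachBimodType B) (phi : dual E) : Prop :=
  wstar_continuous (fun b => lact b phi) /\
  wstar_continuous (fun b => ract phi b).

Definition is_identity (e : B) : Prop :=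
  forall b, bmul e b = b /\ bmul b e = b.

(* That P is a predual of B, i.e. that (B, P) is a dual Banach algebra, is not
   part of the definition, which makes sense without it.  For the bidual of A
   and P = A^*, it follows from the weak compactness of the bounded linear maps
   from A to A^* (Arens regularity). *)
Definition strongly_connes_amenable : Prop :=
  exists2 e : B, is_identity e &
    forall E : banachBimodType B,
      (forall x : E, lact e x = x /\ ract x e = x) ->
      forall D : B -> dual E,
        derivation D -> wstar_continuous D ->
        (forall b, wstar_element (D b)) ->
        inner D.

End ConnesAmenability.

(* A^*, as a subspace of the dual A^*** of A^** *)
Definition bidual_predual (A : normedModType K) : set (dual (dual (dual A))) :=
  range (@evaluation (dual A)).

End Dual.

Arguments bidual_predual {R} A.
Arguments strongly_connes_amenable {R} B P.

(* Main.v *)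
(* The bidual of A carries an identity e, and condition (i) lets one exchange
   the order in Phi_a Psi_b B(a, b) for Phi, Psi in the bidual and B a bounded
   bilinear form on A.  Hence the bounded bilinear forms are a bimodule over the
   bidual, and so is their quotient V by the forms f(ab), f in A^*.  The map
   Phi |-> Phi . (e (x) e) - (e (x) e) . Phi is a w^*-continuous derivation into
   V^* with values in the w^*-elements, so it is implemented by some N in V^*;
   e (x) e - N is then a virtual diagonal M for A.  For a derivation D into E^*,
   phi(x) = M_(a,b) <x . a, D b> satisfies c . phi - phi . c = e . (D c), and
   the remaining derivation D - e . D has trivial left multiplication, which
   makes it inner as well, implemented by x |-> - e_a <x, (D - e . D)(a)>. *)
From HB Require Import structures.
Require Import Defs.
From mathcomp Require Import all_boot all_order all_algebra.
From mathcomp Require Import complex.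
From mathcomp Require Import boolp classical_sets functions reals.
From mathcomp Require Import topology normedtype.
From mathcomp Require Import ring lra.

Set Implicit Arguments.
Unset Strict Implicit.
Unset Printing Implicit Defensive.

Import Order.TTheory GRing.Theory Num.Theory.
Import numFieldNormedType.Exports.

Local Open Scope classical_set_scope.
Local Open Scope ring_scope.
Local Open Scope complex_scope.

(** * Helly's theorem in the bidual *)

Section Helly.
Variables (R : realType).
Local Notation K := R[i].
Variable E : normedModType K.

Lemma Re_le_norm (z : K) (M : R) : `|z| <= M%:C -> complex.Re z <= M.
Proof.
move=> zM; rewrite -lecR; apply: le_trans zM.
by apply: le_trans (normc_ge_Re z); rewrite lecR ler_norm.
Qed.

Lemma Re_scaleC (r : R) (z : K) : complex.Re (r%:C * z) = r * complex.Re z.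
Proof. by case: z => x y /=; rewrite mul0r subr0. Qed.

(** Multiplying a vector by a unimodular scalar makes its value under [f] real and nonnegative, so
    real parts on the ball already detect the norm. *)
Lemma dual_norm_le_Re (f : dual E) (s : R) : 
  (forall a, `|a| <= 1 -> complex.Re (f a) <= s) -> `|f| <= s%:C.
Proof.
move=> fs.
have s0 : 0 <= s by have := fs 0; rewrite normr0 linear0; apply.
apply: dual_norm_le => [|x]; first by rewrite -[0]/(0%:C) lecR.
have [->|x0] := eqVneq x 0; first by rewrite linear0 !normr0 mulr0.
have [->|fx0] := eqVneq (f x) 0.
  by rewrite normr0 mulr_ge0 // -[0]/(0%:C) lecR.
have nx : 0 < `|x| by rewrite normr_gt0.
have nfx : 0 < `|f x| by rewrite normr_gt0.
pose u : K := `|f x| / f x / `|x|.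
have /fs : `|u *: x| <= 1.
  rewrite normrZ !normrM !normfV !normr_id divff ?gt_eqF//.
  by rewrite mul1r mulVf ?gt_eqF.
rewrite linearZ /= (_ : _ *: _ = `|f x| / `|x|); last first.
  by rewrite /u /GRing.scale /=; field; rewrite gt_eqF.
rewrite -lecR ReK_ge0; last by rewrite divr_ge0.
by rewrite ler_pdivrMr.
Qed.

(* At an approximate minimiser a0 of the sum of squares, convexity of the ball
   makes g = sum_f Re (Phi f - f a0) f nearly maximal at a0 on the ball, and
   |Phi| <= 1 then bounds Re (Phi g) by Re (g a0) up to a small error. *)
Lemma helly (Phi : dual (dual E)) (s : seq (dual E)) (eps : R) :
  `|Phi| <= 1 -> 0 < eps ->
  exists2 a, `|a| <= 1 &
    \sum_(f <- s) (complex.Re (Phi f) - complex.Re (f a)) ^+ 2 < eps.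
Proof.
move=> Phi1 eps0.
pose q a := \sum_(f <- s) (complex.Re (Phi f) - complex.Re (f a)) ^+ 2.
pose Q := [set q a | a in [set a : E | `|a| <= 1]].
have Q0 : has_inf Q.
  split; first by exists (q 0); exists 0 => //=; rewrite normr0.
  by exists 0 => _ [a _ <-]; apply: sumr_ge0 => f _; rewrite sqr_ge0.
have [d0|d0] := leP (inf Q) 0.
  have [_ [a a1 <-] qa] := inf_adherent eps0 Q0.
  by exists a => //; apply: lt_le_trans qa _; rewrite gerDr.
set d := inf Q in d0.
have dq a : `|a| <= 1 -> d <= q a.
  by move=> a1; apply: ge_inf; [case: Q0|exists a].
(* [L] bounds the quadratic coefficient of [q] along a segment from [a0] inside the ball, where |a -
   a0| <= 2; the added [d] makes it positive and gives [t <= 1]. *)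
pose L : R := \sum_(f <- s) (2 * complex.Re `|f|) ^+ 2 + d.
have S0 : 0 <= \sum_(f <- s) (2 * complex.Re `|f|) ^+ 2.
  by apply: sumr_ge0 => f _; rewrite sqr_ge0.
have L0 : 0 < L by rewrite /L; lra.
pose t : R := d / (2 * L).
have t0 : 0 < t by rewrite divr_gt0 // mulr_gt0.
have tL : t * L = d / 2 by rewrite /t; field; rewrite gt_eqF.
have t1 : t <= 1 by rewrite ler_pdivrMr ?mulr_gt0// /L; lra.
have eta0 : 0 < t * (d / 2) by rewrite mulr_gt0 // divr_gt0.
have [_ [a0 a01 <-] qa0] := inf_adherent eta0 Q0.
pose w f := complex.Re (Phi f) - complex.Re (f a0).
pose g : dual E := \sum_(f <- s) (w f)%:C *: f.
have gE a : g a = \sum_(f <- s) (w f)%:C * f a.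
  rewrite /g; elim: (s) => [|f r ih]; first by rewrite !big_nil.
  by rewrite !big_cons dual_add ih dual_scale.
have RegE a : complex.Re (g a) = \sum_(f <- s) w f * complex.Re (f a).
  by rewrite gE raddf_sum; apply: eq_bigr => f _; rewrite /= Re_scaleC.
have RePhi : complex.Re (Phi g) = \sum_(f <- s) w f * complex.Re (Phi f).
  rewrite /g linear_sum raddf_sum; apply: eq_bigr => f _.
  by rewrite linearZ /= Re_scaleC.
have key a : `|a| <= 1 -> complex.Re (g a) <= complex.Re (g a0) + d / 2.
  move=> a1; pose b := a0 + t%:C *: (a - a0).
  have b1 : `|b| <= 1.
    rewrite (_ : b = (1 - t)%:C *: a0 + t%:C *: a); last first.
      by rewrite /b rmorphB rmorph1 scalerBl scalerBr scale1r addrA addrAC.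
    apply: le_trans (ler_normD _ _) _; rewrite !normrZ.
    rewrite !ger0_norm -?[0]/(0%:C) ?lecR ?(ltW t0) ?subr_ge0 //.
    rewrite (_ : 1 = (1 - t)%:C + t%:C); last first.
      by rewrite -rmorphD subrK rmorph1.
    by apply: lerD; rewrite ler_piMr // -[0]/(0%:C) lecR ?subr_ge0// ltW.
  have := dq _ b1.
  pose u (f : dual E) := complex.Re (f (a - a0)).
  have -> : q b = q a0 - 2 * t * \sum_(f <- s) w f * u f
      + t ^+ 2 * \sum_(f <- s) u f ^+ 2.
    rewrite /q !mulr_sumr -sumrN -!big_split /=; apply: eq_bigr => f _.
    by rewrite linearD linearZ /= raddfD /= Re_scaleC /w -/(u f); ring.
  have uL : \sum_(f <- s) u f ^+ 2 <= L.
    rewrite /L; apply: ler_wpDr; first exact: ltW.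
    apply: ler_sum => f _; rewrite -real_normK ?num_real //.
    rewrite ler_sqr ?nnegrE //; last first.
      by rewrite mulr_ge0 // -lecR [leLHS](_ : _ = 0) // ReK_ge0.
    rewrite -lecR; apply: le_trans (normc_ge_Re _) _.
    apply: le_trans (ler_dual _ _) _; rewrite rmorphM mulrC.
    rewrite [X in _ <= _ * X](ReK_ge0 (normr_ge0 f)) //.
    apply: ler_wpM2r => //; apply: le_trans (ler_normB _ _) _.
    by rewrite [X in _ <= X](_ : 2%:C = 1 + 1) ?lerD // rmorphD rmorph1.
  have -> : \sum_(f <- s) w f * u f = complex.Re (g a) - complex.Re (g a0).
    rewrite !RegE -sumrB; apply: eq_bigr => f _.
    by rewrite /u linearB raddfB mulrBr.
  set X := complex.Re (g a) - _.
  have t2 : t ^+ 2 * \sum_(f <- s) u f ^+ 2 <= t * (d / 2).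
    by rewrite -tL expr2 -mulrA !ler_pM2l.
  move=> h; have : t * X <= t * (d / 2).
    by rewrite -/d in qa0; rewrite /q in h qa0 *; lra.
  by rewrite ler_pM2l// /X; lra.
have : complex.Re (Phi g) <= complex.Re (g a0) + d / 2.
  apply: Re_le_norm; apply: le_trans (ler_dual _ _) _.
  rewrite (le_trans (ler_wpM2r _ Phi1))// mul1r.
  exact: dual_norm_le_Re.
have := dq _ a01.
(* [q a0] is the sum of the squares of the [w f], that is, the gap of [g] between [Phi] and [a0].
   The gap is at most d / 2, yet [q a0] is at least [d]. *)
have -> : q a0 = complex.Re (Phi g) - complex.Re (g a0).
  by rewrite RePhi RegE -sumrB; apply: eq_bigr => f _; rewrite -mulrBr expr2.
by move=> h1 h2; exfalso; clear -d0 h1 h2; lra.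
Qed.

End Helly.

(** * Iterated pairings and bounded bilinear forms *)

(* The value of [Phi] on [f]; junk value 0 when [f] is not bounded linear. *)
HB.lock Definition dapp (R : realType) (E : normedModType R[i])
    (Phi : dual (dual E)) (f : E -> R[i]^o) : R[i]^o :=
  if pselect (bounded_linear f) is left fP then Phi (mk_dual fP) else 0.

Section BidualApp.
Variables (R : realType).
Local Notation K := R[i].
Variable E : normedModType K.
Implicit Types (Phi Psi : dual (dual E)) (f g : E -> K^o).

Lemma dappE Phi f (fP : bounded_linear f) : dapp Phi f = Phi (mk_dual fP).
Proof.
by rewrite unlock; case: pselect => // fP'; congr (Phi _); exact: dualP.
Qed.

Lemma dapp_dual Phi (f : dual E) : dapp Phi f = Phi f.
Proof.
by rewrite (dappE _ (dual_bounded_linear f)); congr (Phi _); exact: dualP.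
Qed.

Lemma dapp_evaluation x f : bounded_linear f -> dapp (evaluation x) f = f x.
Proof. by move=> fP; rewrite dappE. Qed.

Lemma bl_lin k f g : bounded_linear f -> bounded_linear g ->
  bounded_linear (fun x => k * f x + g x : K^o).
Proof.
move=> fP gP.
by have := dual_bounded_linear (k *: mk_dual fP + mk_dual gP).
Qed.

Lemma dapp_lin Phi k f g : bounded_linear f -> bounded_linear g ->
  dapp Phi (fun x => k * f x + g x) = k * dapp Phi f + dapp Phi g.
Proof.
move=> fP gP; rewrite (dappE _ fP) (dappE _ gP) (dappE _ (bl_lin k fP gP)).
by rewrite -dual_lin; congr (Phi _); exact: dualP.
Qed.

Lemma bl_sub f g : bounded_linear f -> bounded_linear g ->
  bounded_linear (fun x => f x - g x : K^o).
Proof.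
by move=> fP gP; have := dual_bounded_linear (mk_dual fP - mk_dual gP).
Qed.

Lemma dapp_sub Phi f g : bounded_linear f -> bounded_linear g ->
  dapp Phi (fun x => f x - g x) = dapp Phi f - dapp Phi g.
Proof.
move=> fP gP; rewrite (dappE _ fP) (dappE _ gP) (dappE _ (bl_sub fP gP)).
by rewrite -linearB; congr (Phi _); exact: dualP.
Qed.

Lemma bl_opp f : bounded_linear f -> bounded_linear (fun x => - f x : K^o).
Proof. by move=> fP; have := dual_bounded_linear (- mk_dual fP). Qed.

Lemma dapp_opp Phi f : bounded_linear f ->
  dapp Phi (fun x => - f x) = - dapp Phi f.
Proof.
move=> fP; rewrite (dappE _ fP) (dappE _ (bl_opp fP)).
by rewrite -linearN; congr (Phi _); exact: dualP.
Qed.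

Lemma dapp_cst0 Phi : dapp Phi (fun=> 0) = 0.
Proof.
rewrite -[X in dapp _ X](_ : (0 : dual E) = _ :> (E -> _)) //.
by rewrite dapp_dual linear0.
Qed.

Lemma dapp_linl Phi Psi k f :
  dapp (k *: Phi + Psi) f = k * dapp Phi f + dapp Psi f.
Proof. by rewrite unlock; case: pselect => // _; rewrite mulr0 addr0. Qed.

Lemma dapp_norm Phi f (M : K) :
  0 <= M -> (forall x, `|f x| <= M * `|x|) -> `|dapp Phi f| <= `|Phi| * M.
Proof.
move=> M0 fM; rewrite unlock; case: pselect => [fP|_].
  apply: le_trans (ler_dual _ _) _; apply: ler_wpM2l => //.
  exact: dual_norm_le.
by rewrite normr0 mulr_ge0.
Qed.

End BidualApp.

(** * Bounded bilinear forms and second adjoints of weakly compact maps *)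

Section BoundedBilinear.
Variable R : realType.
Local Notation K := R[i].

Lemma bl_comp (E F G : normedModType K) (S : F -> G) (T : E -> F) :
  bounded_linear S -> bounded_linear T -> bounded_linear (fun x => S (T x)).
Proof.
move=> [lS /ge0_bound[M M0 SM]] [lT [N TN]]; split=> [k x y|].
  by rewrite lT lS.
exists (M * N) => x; rewrite (le_trans (SM _))// -mulrA.
by apply: ler_wpM2l => //; exact: TN.
Qed.

Variable A : normedModType K.
Implicit Types (b : A -> A -> K^o) (Phi Psi : dual (dual A)).

Definition bounded_bilinear b : Prop :=
  [/\ forall x, linear (b x), forall y, linear (b^~ y) &
      exists M : K, forall x y, `|b x y| <= M * (`|x| * `|y|)].

Lemma ge0_bilin_bound b : bounded_bilinear b ->
  exists2 M : K, 0 <= M & forall x y, `|b x y| <= M * (`|x| * `|y|).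
Proof.
move=> [_ _ [M bM]]; exists `|M| => // x y; apply: ler_absM => //.
by rewrite mulr_ge0.
Qed.

Lemma bilin_bl2 b x : bounded_bilinear b -> bounded_linear (b x).
Proof.
move=> bb; case: (bb) => lb _ _; split => //.
have [M M0 bM] := ge0_bilin_bound bb.
by exists (M * `|x|) => y; rewrite -mulrA.
Qed.

Lemma bilin_bl1 b y : bounded_bilinear b -> bounded_linear (b^~ y).
Proof.
move=> bb; case: (bb) => _ lb _; split => //.
have [M M0 bM] := ge0_bilin_bound bb.
by exists (M * `|y|) => x; rewrite -mulrA (mulrC `|y|).
Qed.

Lemma bilin_flip b : bounded_bilinear b -> bounded_bilinear (fun x y => b y x).
Proof.
move=> [lb rb [M bM]]; split => //; exists M => x y.
by rewrite (mulrC `|x|).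
Qed.

Lemma bilin_dapp2 b Phi : bounded_bilinear b ->
  bounded_linear (fun x => dapp Phi (b x) : K^o).
Proof.
move=> bb; have [_ lb _] := bb; split=> [k x y|].
  rewrite -[RHS]dapp_lin; [|exact: bilin_bl2..].
  by congr dapp; apply/funext => z; exact: lb.
have [M M0 bM] := ge0_bilin_bound bb.
exists (`|Phi| * M) => x; rewrite -mulrA; apply: dapp_norm.
  by rewrite mulr_ge0.
by move=> y; rewrite -mulrA.
Qed.

Lemma bilin_dapp1 b Phi : bounded_bilinear b ->
  bounded_linear (fun y => dapp Phi (b^~ y) : K^o).
Proof. by move=> /bilin_flip; exact: bilin_dapp2. Qed.

Lemma bilin_comp b (S T : A -> A) : bounded_bilinear b ->
  bounded_linear S -> bounded_linear T ->
  bounded_bilinear (fun x y => b (S x) (T y)).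
Proof.
move=> bb SP TP; split=> [x|y|].
- by have [] := bl_comp (bilin_bl2 (S x) bb) TP.
- by have [] := bl_comp (bilin_bl1 (T y) bb) SP.
have [M M0 bM] := ge0_bilin_bound bb.
have [N N0 SN] := ge0_bound SP.2; have [L L0 TL] := ge0_bound TP.2.
exists (M * (N * L)) => x y; apply: le_trans (bM _ _) _.
rewrite -mulrA; apply: ler_wpM2l => //.
by rewrite mulrACA; apply: ler_pM.
Qed.

Lemma bl_id : bounded_linear (fun x : A => x).
Proof. by split=> //; exists 1 => x; rewrite mul1r. Qed.

(* Bounded nets of A approximating Phi exist by Helly's theorem; a weak cluster
   point of their images is the value of the second adjoint at Phi. *)
Lemma weakly_compact_biadjoint (F : normedModType K) (T : A -> F) Phi :
  bounded_linear T -> weakly_compact T ->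
  exists y : F, forall g : dual F, dapp Phi (fun x => g (T x)) = g y.
Proof.
move=> TP; rewrite /weakly_compact precompactE => cT.
wlog Phi1 : Phi / `|Phi| <= 1.
  (* The added 1 keeps the scaling factor invertible when [Phi] is zero. *)
  move=> wl; pose c : K := `|Phi| + 1.
  have c0 : 0 < c by rewrite ltr_wpDl.
  have [|y yP] := wl (c^-1 *: Phi).
    rewrite normrZ normfV (gtr0_norm c0) ler_pdivrMl // mulr1.
    by rewrite lerDl.
  exists (c *: y) => g; rewrite linearZ /= -yP -[c^-1 *: Phi]addr0 dapp_linl.
  rewrite [dapp 0 _](_ : _ = 0) ?addr0; last by rewrite unlock; case: pselect.
  by rewrite /GRing.scale /= mulrA divff ?gt_eqF// mul1r.
have adj (g : dual F) : bounded_linear (fun x => g (T x) : K^o).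
  by apply: bl_comp => //; exact: dual_bounded_linear.
pose D := [set p : seq (dual F) * R | 0 < p.2].
pose r (z : K) : R := complex.Re z.
(* A basic set consists of the images of ball vectors at which finitely many functionals nearly have
   the real parts prescribed by [Phi]; Helly's theorem makes these sets nonempty. *)
pose B (p : seq (dual F) * R) := [set y : weak F |
  (exists2 x, `|x| <= 1 & y = T x) /\
  \sum_(g <- p.1) (r (dapp Phi (fun x => g (T x))) - r (g y)) ^+ 2 < p.2].
have FF : Filter (filter_from D B).
  apply: filter_from_filter; first by exists ([::], 1); rewrite /D /=.
  move=> [s e] [t d]; rewrite /D /= => e0 d0.
  exists (s ++ t, Order.min e d); first by rewrite /= lt_min e0.
  move=> y [/= xy]; rewrite big_cat /= lt_min => /andP[le ld].
  have sq (u : seq (dual F)) :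
      0 <= \sum_(g <- u) (r (dapp Phi (fun x => g (T x))) - r (g y)) ^+ 2.
    by apply: sumr_ge0 => g _; rewrite sqr_ge0.
  split; split => //=.
    by apply: le_lt_trans le; rewrite lerDl sq.
  by apply: le_lt_trans ld; rewrite lerDr sq.
have PF : ProperFilter (filter_from D B).
  apply: filter_from_proper => -[s e]; rewrite /D /= => e0.
  have [x x1 xs] := helly [seq mk_dual (adj g) | g <- s] Phi1 e0.
  exists (T x); split; first by exists x.
  apply: le_lt_trans xs; rewrite big_map /=; apply: ler_sum => g _.
  by rewrite (dappE _ (adj g)).
(* The filter contains the image of the ball, hence its weak closure, which is compact; [y] is a
   cluster point. *)
have [|y [_ yF]] := cT _ PF.
  apply: (@filterS _ _ FF _ _ (@subset_closure _ _)).
  exists ([::], 1); rewrite /D //= => y [[x x1 ->] _].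
  by exists x.
have Reg (g : dual F) : r (dapp Phi (fun x => g (T x))) = r (g y).
  apply/eqP; rewrite -subr_eq0 -normr_eq0; apply/eqP/le_anti.
  rewrite normr_ge0 andbT; apply/ler_addgt0Pr => e e0; rewrite add0r.
  have e2 : 0 < e / 2 by rewrite divr_gt0.
  have gc : {for (y : weak F), continuous (g : weak F -> K^o)}.
    pose p (x : F) (f : dual F) : K^o := f x.
    apply: (@continuous_comp (weak F) {ptws dual F -> K^o} K^o
              p (fun h => h g)).
      exact: (@initial_continuous _ {ptws dual F -> K^o}).
    exact: (@proj_continuous _ (fun _ : dual F => K^o : topologicalType) g).
  have ny : nbhs (y : weak F) [set z : weak F | `|r (g y) - r (g z)| < e / 2].
    have e2C : 0 < (e / 2)%:C :> K by rewrite ltcR.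
    have := @cvgr_dist_lt K K^o _ _ _ (g : weak F -> K^o) _ gc _ e2C.
    move=> h; have FFy : Filter (nbhs (y : weak F)) by exact: nbhs_filter.
    apply: filterS (h FFy) => z gyz; rewrite /= -ltcR -raddfB.
    exact: le_lt_trans (normc_ge_Re _) gyz.
  have Fy : filter_from D B (B ([:: g], (e / 2) ^+ 2)).
    by exists ([:: g], (e / 2) ^+ 2) => //; rewrite /D /= exprn_gt0.
  have [z [[_ /= zB] /= zy]] := yF _ _ Fy ny.
  move: zB; rewrite big_seq1 -real_normK ?num_real //.
  rewrite ltr_sqr ?nnegrE ?(ltW e2) // => zB.
  rewrite -(subrKA (r (g z))) (le_trans (ler_normD _ _))// [leRHS]splitr.
  by rewrite lerD ?(ltW zB) // distrC ltW.
(* Since Re (i z) = - Im z, the equality of real parts for i g gives that of imaginary parts for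
   [g]. *)
exists y => g; apply/eqP; rewrite eq_complex -!/(r _) Reg eqxx /=.
have /= := Reg ('i *: g).
rewrite (_ : dapp _ _ = 'i * dapp Phi (fun x => g (T x))); last first.
  rewrite (dappE _ (adj g)).
  transitivity (Phi ('i *: mk_dual (adj g))); last by rewrite linearZ.
  rewrite -dapp_dual.
  by congr dapp; apply/funext.
rewrite [X in _ = r X](_ : _ = 'i * g y) //.
case: (dapp _ _) => u v; case: (g y) => u' v' /=.
by rewrite !mul0r !mul1r !sub0r => /oppr_inj ->.
Qed.

End BoundedBilinear.

(** * Bilinear forms vanishing at e in the second variable *)

Section NullBilin.
Variables (R : realType).
Local Notation K := R[i].
Variables (A : normedModType K) (e : dual (dual A)).

(** A model of the quotient V without quotient spaces: if [e] is an identity, each bounded form has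
    exactly one such representative modulo the forms f(xy), because e_y f(xy) = f(x). *)
Definition null_bilin_pred : {pred A -> A -> K^o} :=
  [pred b | `[< bounded_bilinear b /\ forall x, dapp e (b x) = 0 >]].

Lemma bilin_lin k (b c : A -> A -> K^o) :
  bounded_bilinear b -> bounded_bilinear c ->
  bounded_bilinear (fun x y => k * b x y + c x y : K^o).
Proof.
move=> bb cc; split=> [x|y|].
- by have [] := bl_lin k (bilin_bl2 x bb) (bilin_bl2 x cc).
- by have [] := bl_lin k (bilin_bl1 y bb) (bilin_bl1 y cc).
have [M M0 bM] := ge0_bilin_bound bb; have [N N0 cN] := ge0_bilin_bound cc.
exists (`|k| * M + N) => x y; apply: le_trans (ler_normD _ _) _.
by rewrite mulrDl lerD// normrM -mulrA ler_wpM2l.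
Qed.

Lemma bilin0 : bounded_bilinear (fun _ _ : A => 0 : K^o).
Proof.
split=> [x k y z|y k x z|]; rewrite ?scaler0 ?addr0//.
by exists 0 => x y; rewrite normr0 mul0r.
Qed.

Lemma null_bilin_submod : submod_closed null_bilin_pred.
Proof.
split.
  apply/asboolP; split; first exact: bilin0.
  by move=> x; exact: dapp_cst0.
move=> k b c /asboolP[bb b0] /asboolP[cc c0].
apply/asboolP; split; first exact: bilin_lin.
move=> x; have := dapp_lin e k (bilin_bl2 x bb) (bilin_bl2 x cc).
by rewrite b0 c0 mulr0 addr0.
Qed.

HB.instance Definition _ :=
  GRing.isSubmodClosed.Build K (A -> A -> K^o)
    null_bilin_pred null_bilin_submod.

Record null_bilin : Type := NullBilin {
  null_bilin_fun :> A -> A -> K^o;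
  _ : null_bilin_fun \in null_bilin_pred
}.

HB.instance Definition _ := [isSub for null_bilin_fun].
HB.instance Definition _ := [Choice of null_bilin by <:].
HB.instance Definition _ := [SubChoice_isSubLmodule of null_bilin by <:].

Lemma null_bilinP (b c : null_bilin) : (forall x y, b x y = c x y) -> b = c.
Proof. by move=> bc; apply/val_inj/funext => x; apply/funext => y. Qed.

Lemma null_bilin_bounded (b : null_bilin) : bounded_bilinear b.
Proof. by case: b => b /= /asboolP[]. Qed.

Lemma null_bilin_null (b : null_bilin) x : dapp e (b x) = 0.
Proof. by case: b => b /= /asboolP[]. Qed.

Lemma mk_null_bilin_subproof (b : A -> A -> K^o) :
  bounded_bilinear b -> (forall x, dapp e (b x) = 0) -> b \in null_bilin_pred.
Proof. by move=> ? ?; apply/asboolP. Qed.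

Definition mk_null_bilin b bb b0 : null_bilin :=
  NullBilin (@mk_null_bilin_subproof b bb b0).

Lemma null_bilin_add (b c : null_bilin) x y : (b + c) x y = b x y + c x y.
Proof. by []. Qed.

Lemma null_bilin_scale (k : K) (b : null_bilin) x y : (k *: b) x y = k * b x y.
Proof. by []. Qed.

(** At a zero vector the quotient is 0, as the inverse of 0 is 0; such pairs leave the supremum
    unharmed and show that it is nonnegative. *)
Definition null_bilin_values (b : null_bilin) : set R :=
  [set r | exists x y, r = complex.Re (`|b x y| / (`|x| * `|y|))].

Definition null_bilin_norm (b : null_bilin) : K :=
  (sup (null_bilin_values b))%:C.

Implicit Types (b c : null_bilin) (k : K).

Lemma null_bilin_has_sup b : has_sup (null_bilin_values b).
Proof.
split; first by eexists; exists 0, 0.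
have [M M0 bM] := ge0_bilin_bound (null_bilin_bounded b).
exists (complex.Re M) => _ [x [y ->]].
rewrite -lecR !ReK_ge0 //; last by rewrite divr_ge0 ?mulr_ge0.
have [->|xy0] := eqVneq (`|x| * `|y|) 0; first by rewrite invr0 mulr0.
by rewrite ler_pdivrMr // lt_def xy0 mulr_ge0.
Qed.

Lemma null_bilin_norm_ge0 b : 0 <= null_bilin_norm b.
Proof.
rewrite -[0]/(0%:C) lecR; apply: sup_upper_bound.
  exact: null_bilin_has_sup.
by exists 0, 0; rewrite normr0 mul0r invr0 mulr0.
Qed.

Lemma ler_null_bilin_norm b x y : `|b x y| <= null_bilin_norm b * (`|x| * `|y|).
Proof.
have [xy0|xy0] := eqVneq (`|x| * `|y|) 0.
  have [M M0 bM] := ge0_bilin_bound (null_bilin_bounded b).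
  by have := bM x y; rewrite xy0 !mulr0.
rewrite -ler_pdivrMr; last by rewrite lt_def xy0 mulr_ge0.
rewrite -[leLHS]ReK_ge0; last by rewrite divr_ge0 ?mulr_ge0.
rewrite lecR; apply: sup_upper_bound; first exact: null_bilin_has_sup.
by exists x, y.
Qed.

Lemma null_bilin_norm_le b (M : K) : 0 <= M ->
  (forall x y, `|b x y| <= M * (`|x| * `|y|)) -> null_bilin_norm b <= M.
Proof.
move=> M0 bM; rewrite -(ReK_ge0 M0) lecR; apply: ge_sup.
  by case: (null_bilin_has_sup b).
move=> _ [x [y ->]]; rewrite -lecR !ReK_ge0 //; last first.
  by rewrite divr_ge0 ?mulr_ge0.
have [->|xy0] := eqVneq (`|x| * `|y|) 0; first by rewrite invr0 mulr0.
by rewrite ler_pdivrMr // lt_def xy0 mulr_ge0.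
Qed.

Lemma null_bilin_norm_triangle b c :
  null_bilin_norm (b + c) <= null_bilin_norm b + null_bilin_norm c.
Proof.
apply: null_bilin_norm_le => [|x y].
  by rewrite addr_ge0 ?null_bilin_norm_ge0.
rewrite null_bilin_add mulrDl (le_trans (ler_normD _ _))// lerD//;
  exact: ler_null_bilin_norm.
Qed.

Lemma null_bilin_norm_scale_le k b :
  null_bilin_norm (k *: b) <= `|k| * null_bilin_norm b.
Proof.
apply: null_bilin_norm_le => [|x y].
  by rewrite mulr_ge0 ?null_bilin_norm_ge0.
by rewrite null_bilin_scale normrM -mulrA ler_wpM2l ?ler_null_bilin_norm.
Qed.

Lemma null_bilin_norm_scale k b :
  null_bilin_norm (k *: b) = `|k| * null_bilin_norm b.
Proof.
apply/le_anti; rewrite null_bilin_norm_scale_le /=.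
have [->|k0] := eqVneq k 0; first by rewrite normr0 mul0r null_bilin_norm_ge0.
rewrite -ler_pdivlMl ?normr_gt0// -normfV.
apply: le_trans (null_bilin_norm_scale_le _ _).
by rewrite scalerA mulVf// scale1r.
Qed.

Lemma null_bilin_norm_eq0 b : null_bilin_norm b = 0 -> b = 0.
Proof.
move=> b0; apply: null_bilinP => x y; apply/eqP.
by rewrite -normr_le0 (le_trans (ler_null_bilin_norm b x y))// b0 mul0r.
Qed.

HB.instance Definition _ := Lmodule_isNormed.Build K null_bilin
  null_bilin_norm_triangle null_bilin_norm_scale null_bilin_norm_eq0.

Lemma ler_null_bilin (b : null_bilin) x y : `|b x y| <= `|b| * (`|x| * `|y|).
Proof. exact: ler_null_bilin_norm. Qed.

(** The limit is taken pointwise; the Cauchy condition makes the convergence uniform relative to |x|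
    |y|, so bilinearity, boundedness and vanishing at [e] pass to the limit. *)
Lemma null_bilin_complete (F : set_system null_bilin) :
  ProperFilter F -> cauchy F -> cvg F.
Proof.
move=> FF /cauchy_ballP cF; apply/cvg_ex.
have FF' : Filter F := @filter_filter _ F FF.
have cvxy (x y : A) : exists l : K^o,
    (fun b : null_bilin => b x y : K^o) @ F --> l.
  apply/cvg_ex; apply: complex_complete; apply/cauchy_ballP => d d0.
  have n1 : 0 < `|x| * `|y| + 1 by rewrite ltr_wpDl// mulr_ge0.
  have := cF _ (divr_gt0 d0 n1); rewrite /prop_near1 /nbhs /=.
  case=> -[P Q] /= [FP FQ] PQ.
  pose ev (b : null_bilin) := b x y.
  exists (ev @` P, ev @` Q) => /=.
    by split; [apply: filterS FP => f Pf|apply: filterS FQ => f Qf]; exists f.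
  move=> [_ _] /= [[f Pf <-] [g Qg <-]]; rewrite /ball /=.
  have := PQ (f, g) (conj Pf Qg); rewrite -ball_normE /= => fg.
  rewrite (le_lt_trans (ler_null_bilin (f - g) x y))//.
  apply: le_lt_trans (_ : `|f - g| * (`|x| * `|y| + 1) < _).
    by rewrite ler_wpM2l// lerDl.
  by rewrite -ltr_pdivlMr.
pose g x y := projT1 (cid (cvxy x y)).
have gP x y : (fun b : null_bilin => b x y : K^o) @ F --> g x y :=
  projT2 (cid (cvxy x y)).
have est (d : K) : 0 < d -> F [set b : null_bilin |
    forall x y, `|b x y - g x y| <= d * (`|x| * `|y|)].
  move=> d0; have := @nearP_dep _ _ F F FF' FF' _ (cF _ d0).
  apply: filterS => f fh x y.
  apply/ler_addgt0Pr => c c0.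
  have /filter_ex[h [hf hg]] : F [set h : null_bilin |
      ball f d h /\ `|g x y - h x y| < c].
    apply: filterI => //.
    exact: (@cvgr_dist_lt K K^o _ _ _ (fun b : null_bilin => b x y)
              (g x y) (gP x y) c c0).
  rewrite -(subrKA (h x y)) (le_trans (ler_normD _ _))// lerD//; last first.
    by rewrite distrC ltW.
  rewrite (le_trans (ler_null_bilin (f - h) x y))//.
  by rewrite ler_wpM2r ?mulr_ge0// ltW//; move: hf; rewrite -ball_normE.
have gbil : bounded_bilinear g.
  split=> [x k y z|y k x z|].
  - apply: (cvg_unique (@norm_hausdorff _ _) (gP _ _)).
    rewrite (_ : (fun b : null_bilin => _) =
      (fun b : null_bilin => k *: (b x y : K^o) + b x z)); last first.
      by apply/funext => b; have [-> _ _] := null_bilin_bounded b.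
    apply: (@cvgD K K^o _ F FF'); [apply: (@cvgZr K K^o _ F FF')|];
      exact: gP.
  - apply: (cvg_unique (@norm_hausdorff _ _) (gP _ _)).
    rewrite (_ : (fun b : null_bilin => _) =
      (fun b : null_bilin => k *: (b x y : K^o) + b z y)); last first.
      by apply/funext => b; have [_ -> _] := null_bilin_bounded b.
    apply: (@cvgD K K^o _ F FF'); [apply: (@cvgZr K K^o _ F FF')|];
      exact: gP.
  have /filter_ex[f fP] := est 1 ltr01.
  exists (`|f| + 1) => x y; rewrite -(subKr (f x y) (g x y)) mulrDl.
  by rewrite (le_trans (ler_normB _ _))// lerD// ler_null_bilin.
have g0 x : dapp e (g x) = 0.
  apply/eqP; rewrite -normr_eq0; apply/eqP/le_anti; rewrite normr_ge0 andbT.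
  apply/ler_addgt0Pr => d d0; rewrite add0r.
  have n1 : 0 < `|e| * `|x| + 1 by rewrite ltr_wpDl// mulr_ge0.
  have /filter_ex[f fP] := est _ (divr_gt0 d0 n1).
  (* The approximant [f] vanishes at [e], so e (g x) equals minus e (f x - g x), which the uniform
     estimate makes small. *)
  rewrite -normrN -[- _]add0r -(null_bilin_null f x).
  have fx := bilin_bl2 x (null_bilin_bounded f).
  rewrite -(dapp_sub e fx (bilin_bl2 x gbil)).
  apply: (@le_trans _ _ (`|e| * (d / (`|e| * `|x| + 1) * `|x|))).
    apply: dapp_norm => [|y]; last by have := fP x y; rewrite mulrA.
    by rewrite mulr_ge0// divr_ge0 ?ltW.
  by rewrite mulrCA mulrAC ler_pdivrMr// ler_wpM2l ?(ltW d0)// lerDl.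
exists (mk_null_bilin gbil g0); apply/fcvgrPdist_lt => d d0.
have d20 : 0 < d / 2 by rewrite divr_gt0.
apply: filterS (est _ d20) => f fP.
rewrite distrC (@le_lt_trans _ _ (d / 2))//; last first.
  by rewrite ltr_pdivrMr// ltr_pMr// ltr1n.
by apply: null_bilin_norm_le; [exact: ltW|exact: fP].
Qed.

HB.instance Definition _ :=
  Uniform_isComplete.Build null_bilin null_bilin_complete.

End NullBilin.

(** * The Arens product and interchange of limits *)

Section ArensCalculus.
Variables (R : realType).
Local Notation K := R[i].
Variable A : banachAlgType K.
Implicit Types (f : A -> K^o) (b : A -> A -> K^o) (Phi Psi : dual (dual A)).

(** Arens regularity in bilinear form: for b(x, y) = f(xy) the two sides are the first and the
    second Arens product of [Phi] and [Psi] at f. *)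
Definition swappable : Prop := forall b, bounded_bilinear b -> forall Phi Psi,
  dapp Phi (fun x => dapp Psi (b x)) = dapp Psi (fun y => dapp Phi (b^~ y)).

(** For T x = b(x, .), weak compactness places the second adjoint at [Phi] in the dual of [A].
    Evaluations identify that element as y |-> Phi_x b(x, y), and testing it with [Psi] gives the
    interchange. *)
Lemma weakly_compact_swappable :
  (forall T : A -> dual A, bounded_linear T -> weakly_compact T) -> swappable.
Proof.
move=> wc b bb Phi Psi.
pose T x := mk_dual (bilin_bl2 x bb).
have TP : bounded_linear T.
  split=> [k x y|]; first by apply: dualP => z; case: (bb) => _ lb _; exact: lb.
  have [M M0 bM] := ge0_bilin_bound bb.
  exists M => x; apply: dual_norm_le; first by rewrite mulr_ge0.
  by move=> y; rewrite -mulrA; exact: bM.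
have [g gP] := weakly_compact_biadjoint Phi TP (wc T TP).
have gE y : g y = dapp Phi (b^~ y) by have /= <- := gP (evaluation y).
rewrite [LHS](_ : _ = dapp Phi (fun x => Psi (T x))).
  by rewrite gP -dapp_dual; congr dapp; apply/funext => y; exact: gE.
by congr dapp; apply/funext => x; rewrite -dapp_dual.
Qed.

Lemma bl_mull (a : A) : bounded_linear (bmul a).
Proof.
split=> [k x y|]; first by rewrite bmulDr bmulZr.
by exists `|a| => x; exact: bmul_norm.
Qed.

Lemma bl_mulr (a : A) : bounded_linear (fun x => bmul x a).
Proof.
split=> [k x y|]; first by rewrite bmulDl bmulZl.
by exists `|a| => x; rewrite mulrC; exact: bmul_norm.
Qed.

Lemma bl_mul2 (a c : A) : bounded_linear (fun x => bmul a (bmul c x)).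
Proof. by apply: bl_comp; exact: bl_mull. Qed.

Lemma bilin_mul f : bounded_linear f ->
  bounded_bilinear (fun x y => f (bmul x y)).
Proof.
move=> fP; split=> [x|y|].
- by have [] := bl_comp fP (bl_mull x).
- by have [] := bl_comp fP (bl_mulr y).
have [M M0 fM] := ge0_bound fP.2.
exists M => x y; apply: le_trans (fM _) _.
by apply: ler_wpM2l => //; exact: bmul_norm.
Qed.

Lemma dapp_arens Phi Psi f : bounded_linear f ->
  dapp (bmul Phi Psi) f = dapp Phi (fun x => dapp Psi (fun y => f (bmul x y))).
Proof.
move=> fP; rewrite (dappE _ fP) (dappE _ (bilin_dapp2 Psi (bilin_mul fP))).
congr (Phi _); apply: dualP => x /=.
by rewrite (dappE _ (bilin_bl2 x (bilin_mul fP))); congr (Psi _); exact: dualP.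
Qed.

Lemma dapp_identityr e Phi f : is_identity e -> bounded_linear f ->
  dapp Phi (fun x => dapp e (fun y => f (bmul x y))) = dapp Phi f.
Proof. by move=> eP fP; rewrite -dapp_arens// (eP Phi).2. Qed.

Lemma dapp_identityl e Phi f : is_identity e -> bounded_linear f ->
  dapp e (fun x => dapp Phi (fun y => f (bmul x y))) = dapp Phi f.
Proof. by move=> eP fP; rewrite -dapp_arens// (eP Phi).1. Qed.

(** The identity law of the bidual, read at the evaluation functional of [a]. *)
Lemma dapp_identity_mull e f a : is_identity e -> bounded_linear f ->
  dapp e (fun x => f (bmul a x)) = f a.
Proof.
move=> eP fP; have := dapp_identityr (evaluation a) eP fP.
by rewrite !dapp_evaluation//; exact: bilin_dapp2 (bilin_mul fP).
Qed.

Lemma dapp_identity_mulr e f a : is_identity e -> bounded_linear f ->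
  dapp e (fun x => f (bmul x a)) = f a.
Proof.
move=> eP fP; have := dapp_identityl (evaluation a) eP fP.
rewrite dapp_evaluation// => <-; congr dapp; apply/funext => x.
by rewrite dapp_evaluation//; exact: bl_comp fP (bl_mull x).
Qed.

(** The weak-star topology on the target is initial for the evaluations at the points x, and each
    Phi |-> Phi(f) is one of the functionals defining the topology on the bidual. *)
Lemma wstar_continuous_pointwise (E : normedModType K)
    (T : dual (dual A) -> dual E) :
  (forall x, exists2 f : A -> K^o, bounded_linear f &
     forall Phi, T Phi x = dapp Phi f) ->
  wstar_continuous (bidual_predual A) T.
Proof.
move=> TP.
apply: continuous_comp_initial => /= Phi.
have FPhi : Filter (nbhs (Phi : predual_topology (bidual_predual A))).
  exact: nbhs_filter.
set G := _ \o T.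
have GPhi : Filter (G @ (Phi : predual_topology (bidual_predual A))).
  exact: fmap_filter.
apply/cvg_sup => x.
apply/cvg_image.
  (* Evaluation at [x] is onto, as constant functions take every value; [cvg_image] asks for
     this. *)
  by rewrite eqEsubset; split=> v // _; exists (cst v).
have [f fP TE] := TP x.
have P0 : evaluation (mk_dual fP) \in bidual_predual A.
  by rewrite inE; exists (mk_dual fP).
pose p0 : set_type (bidual_predual A) := SigSub P0.
pose p (b : dual (dual A)) (h : set_type (bidual_predual A)) : K^o :=
  (val h : dual (dual (dual A))) b.
have pc : {for (Phi : predual_topology (bidual_predual A)),
    continuous (fun Psi : predual_topology (bidual_predual A) => p Psi p0)}.
  apply: (@continuous_comp (predual_topology (bidual_predual A))
            {ptws set_type (bidual_predual A) -> K^o} K^o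
            p (fun h => h p0) Phi).
    exact: (@initial_continuous _ {ptws set_type (bidual_predual A) -> K^o}).
  exact: (@proj_continuous _
            (fun _ : set_type (bidual_predual A) => K^o : topologicalType) p0).
move=> W WT; have /pc : nbhs (p Phi p0) W.
  by rewrite /p /= -dappE -TE.
move=> pW; exists [set h : {ptws E -> K^o} | W (h x)].
  apply: (@filterS _ _ FPhi (fun Psi => W (p Psi p0)) _ _ pW) => Psi /=.
  rewrite /G /p /= TE dappE.
  exact.
rewrite eqEsubset; split=> [_ [h Wh <-]//|v Wv]; by exists (cst v).
Qed.
End ArensCalculus.

(** * The bimodule of bilinear forms over the bidual *)

Section NullBilinBimodule.
Variables (R : realType).
Local Notation K := R[i].
Variable A : banachAlgType K.
Implicit Types (b : A -> A -> K^o) (Phi Psi : dual (dual A)).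

Lemma bilin_dapp_bound Phi (t : A -> A -> A -> K^o) (M : K) : 0 <= M ->
  (forall x y z, `|t x y z| <= M * (`|x| * (`|y| * `|z|))) ->
  exists N : K, forall x y, `|dapp Phi (t x y)| <= N * (`|x| * `|y|).
Proof.
move=> M0 tM; exists (`|Phi| * M) => x y; rewrite -mulrA.
apply: dapp_norm => [|z]; first by rewrite !mulr_ge0.
by rewrite -!mulrA.
Qed.

Lemma bilin_dapp_mulr b Phi : bounded_bilinear b ->
  bounded_bilinear (fun x y => dapp Phi (fun z => b x (bmul y z)) : K^o).
Proof.
move=> bb; split=> [x|y|].
- by have [] := bilin_dapp2 Phi (bilin_mul (bilin_bl2 x bb)).
- by have [] := bilin_dapp2 Phi (bilin_comp bb (@bl_id _ A) (bl_mull y)).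
have [M M0 bM] := ge0_bilin_bound bb.
apply: (bilin_dapp_bound Phi M0) => x y z; apply: le_trans (bM _ _) _.
by rewrite !ler_wpM2l// bmul_norm.
Qed.

Lemma bilin_dapp_mul b Phi : bounded_bilinear b ->
  bounded_bilinear (fun x y => dapp Phi (b (bmul x y)) : K^o).
Proof.
move=> bb; split=> [x|y|].
- by have [] := bl_comp (bilin_dapp2 Phi bb) (bl_mull x).
- by have [] := bl_comp (bilin_dapp2 Phi bb) (bl_mulr y).
have [M M0 bM] := ge0_bilin_bound bb.
apply: (bilin_dapp_bound Phi M0) => x y z; apply: le_trans (bM _ _) _.
by rewrite ler_wpM2l// mulrA ler_wpM2r// bmul_norm.
Qed.

Lemma bilin_dapp_mull b Phi : bounded_bilinear b ->
  bounded_bilinear (fun x y => dapp Phi (fun z => b (bmul z x) y) : K^o).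
Proof.
move=> bb; split=> [x|y|].
- by have [] := bilin_dapp1 Phi (bilin_comp bb (bl_mulr x) (@bl_id _ A)).
- by have [] := bilin_dapp1 Phi (bilin_mul (bilin_bl1 y bb)).
have [M M0 bM] := ge0_bilin_bound bb.
apply: (bilin_dapp_bound Phi M0) => x y z; apply: le_trans (bM _ _) _.
rewrite ler_wpM2l// (mulrC `|y|) mulrA ler_wpM2r// mulrC bmul_norm//.
Qed.

Lemma bilin_sub b c : bounded_bilinear b -> bounded_bilinear c ->
  bounded_bilinear (fun x y => b x y - c x y : K^o).
Proof.
move=> bb cc; have := bilin_lin (-1) cc bb.
congr bounded_bilinear; apply/funext => x; apply/funext => y.
by rewrite mulN1r addrC.
Qed.

Variables (e : dual (dual A)) (sw : swappable A) (eid : is_identity e).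

(** Both proofs are arguments of the type so that the bimodule structure, whose laws rest on them,
    can be attached to it. *)
Definition null_bilin_bimod of swappable A & is_identity e := null_bilin e.
Local Notation V := (null_bilin_bimod sw eid).
HB.instance Definition _ := CompleteNormedModule.on V.
Implicit Types v w : V.

Let bbv v : bounded_bilinear v := null_bilin_bounded v.
Let v0 v x : dapp e (v x) = 0 := null_bilin_null v x.

Lemma nb_lact_bilin Phi v : bounded_bilinear (fun x y =>
  dapp Phi (fun z => v x (bmul y z)) - dapp Phi (v (bmul x y)) : K^o).
Proof.
by apply: bilin_sub; [exact: bilin_dapp_mulr|exact: bilin_dapp_mul].
Qed.

(** The first term is the action on forms, the second its normalisation by a form in xy. Applying
    [e] in y turns both into Phi (v x), by the left and the right identity law respectively. *)
Lemma nb_lact_null Phi v x : dapp e (fun y =>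
  dapp Phi (fun z => v x (bmul y z)) - dapp Phi (v (bmul x y)) : K^o) = 0.
Proof.
rewrite dapp_sub; first last.
- exact: bilin_bl2 (bilin_dapp_mul Phi (bbv v)).
- exact: bilin_bl2 (bilin_dapp_mulr Phi (bbv v)).
have e1 : dapp e (fun y => dapp Phi (fun z => v x (bmul y z))) = dapp Phi (v x).
  exact: dapp_identityl eid (bilin_bl2 x (bbv v)).
have e2 : dapp e (fun y => dapp Phi (v (bmul x y))) = dapp Phi (v x).
  exact: dapp_identity_mull x eid (bilin_dapp2 Phi (bbv v)).
by rewrite e1 e2; exact: (@subrr K^o).
Qed.

(* The quotient action on bilinear forms modulo the forms [f (x y)], carried
   over to the representatives that vanish at [e] in the second variable. *)
Definition nb_lact Phi v : V :=
  mk_null_bilin (nb_lact_bilin Phi v) (nb_lact_null Phi v).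

(** After the interchange [e] acts first, on the second variable of [v], where it gives zero. *)
Lemma nb_ract_null Phi v x :
  dapp e (fun y => dapp Phi (fun z => v (bmul z x) y)) = 0.
Proof.
have := sw (bilin_comp (bbv v) (bl_mulr x) (@bl_id _ A)) Phi e => <-.
rewrite (_ : (fun x => _) = (fun=> 0)); last by apply/funext => z; exact: v0.
exact: dapp_cst0.
Qed.

Definition nb_ract v Phi : V :=
  mk_null_bilin (bilin_dapp_mull Phi (bbv v)) (nb_ract_null Phi v).

Lemma nb_lactE Phi v x y : nb_lact Phi v x y =
  dapp Phi (fun z => v x (bmul y z)) - dapp Phi (v (bmul x y)).
Proof. by []. Qed.

Lemma nb_ractE Phi v x y :
  nb_ract v Phi x y = dapp Phi (fun z => v (bmul z x) y).
Proof. by []. Qed.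

Let bl_r v x y : bounded_linear (fun z => v x (bmul y z)).
Proof. exact: bl_comp (bilin_bl2 x (bbv v)) (bl_mull y). Qed.

Let bl_l v x y : bounded_linear (fun z => v (bmul z x) y).
Proof. exact: bl_comp (bilin_bl1 y (bbv v)) (bl_mulr x). Qed.

Let lact_lin1 k Phi Psi v :
  nb_lact (k *: Phi + Psi) v = k *: nb_lact Phi v + nb_lact Psi v.
Proof.
apply: null_bilinP => x y; rewrite null_bilin_add null_bilin_scale.
rewrite !nb_lactE !dapp_linl mulrBr.
by rewrite opprD addrACA.
Qed.

Let lact_lin2 k Phi v w :
  nb_lact Phi (k *: v + w) = k *: nb_lact Phi v + nb_lact Phi w.
Proof.
apply: null_bilinP => x y.
rewrite null_bilin_add null_bilin_scale !nb_lactE mulrBr.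
rewrite [dapp _ _](dapp_lin Phi k (bl_r v x y) (bl_r w x y)).
have [P1 P2] := (bilin_bl2 (bmul x y) (bbv v), bilin_bl2 (bmul x y) (bbv w)).
rewrite [X in _ - X](dapp_lin Phi k P1 P2).
by rewrite opprD addrACA.
Qed.

Let ract_lin1 k Phi Psi v :
  nb_ract v (k *: Phi + Psi) = k *: nb_ract v Phi + nb_ract v Psi.
Proof.
apply: null_bilinP => x y.
by rewrite null_bilin_add null_bilin_scale !nb_ractE !dapp_linl.
Qed.

Let ract_lin2 k Phi v w :
  nb_ract (k *: v + w) Phi = k *: nb_ract v Phi + nb_ract w Phi.
Proof.
apply: null_bilinP => x y; rewrite null_bilin_add null_bilin_scale !nb_ractE.
exact: (dapp_lin Phi k (bl_l v x y) (bl_l w x y)).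
Qed.

Let lDl Phi Psi v : nb_lact (Phi + Psi) v = nb_lact Phi v + nb_lact Psi v.
Proof. by have := lact_lin1 1 Phi Psi v; rewrite !scale1r. Qed.

Let lDr Phi v w : nb_lact Phi (v + w) = nb_lact Phi v + nb_lact Phi w.
Proof. by have := lact_lin2 1 Phi v w; rewrite !scale1r. Qed.

Let rDl v w Phi : nb_ract (v + w) Phi = nb_ract v Phi + nb_ract w Phi.
Proof. by have := ract_lin2 1 Phi v w; rewrite !scale1r. Qed.

Let rDr v Phi Psi : nb_ract v (Phi + Psi) = nb_ract v Phi + nb_ract v Psi.
Proof. by have := ract_lin1 1 Phi Psi v; rewrite !scale1r. Qed.

Let l0l v : nb_lact 0 v = 0.
Proof. by apply: (addrI (nb_lact 0 v)); rewrite -lDl !addr0. Qed.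
Let l0r Phi : nb_lact Phi 0 = 0.
Proof. by apply: (addrI (nb_lact Phi 0)); rewrite -lDr !addr0. Qed.
Let r0l Phi : nb_ract 0 Phi = 0.
Proof. by apply: (addrI (nb_ract 0 Phi)); rewrite -rDl !addr0. Qed.
Let r0r v : nb_ract v 0 = 0.
Proof. by apply: (addrI (nb_ract v 0)); rewrite -rDr !addr0. Qed.

Let lZl (k : K) Phi v : nb_lact (k *: Phi) v = k *: nb_lact Phi v.
Proof. by have := lact_lin1 k Phi 0 v; rewrite l0l !addr0. Qed.
Let lZr (k : K) Phi v : nb_lact Phi (k *: v) = k *: nb_lact Phi v.
Proof. by have := lact_lin2 k Phi v 0; rewrite l0r !addr0. Qed.
Let rZl (k : K) v Phi : nb_ract (k *: v) Phi = k *: nb_ract v Phi.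
Proof. by have := ract_lin2 k Phi v 0; rewrite r0l !addr0. Qed.
Let rZr (k : K) v Phi : nb_ract v (k *: Phi) = k *: nb_ract v Phi.
Proof. by have := ract_lin1 k Phi 0 v; rewrite r0r !addr0. Qed.

Let lM Phi Psi v : nb_lact (bmul Phi Psi) v = nb_lact Phi (nb_lact Psi v).
Proof.
apply: null_bilinP => x y.
have P1 := bilin_dapp2 Psi (bilin_mul (bl_r v x y)).
have P2 := bl_comp (bilin_dapp2 Psi (bbv v)) (bl_mul2 x y).
have P3 := bilin_dapp2 Psi (bilin_mul (bilin_bl2 (bmul x y) (bbv v))).
(* [a1] and [a3] make up the action of the product; [a2] comes from the normalisation of the inner
   action and cancels between [E1] and [E2]. *)
pose a1 := dapp Phi (fun c => dapp Psi (fun d => v x (bmul y (bmul c d)))).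
pose a2 := dapp Phi (fun c => dapp Psi (v (bmul x (bmul y c)))).
pose a3 := dapp Phi (fun c => dapp Psi (fun d => v (bmul x y) (bmul c d))).
have H1 : dapp (bmul Phi Psi) (fun z => v x (bmul y z)) = a1.
  exact: dapp_arens (bl_r v x y).
have H2 : dapp (bmul Phi Psi) (v (bmul x y)) = a3.
  exact: dapp_arens (bilin_bl2 (bmul x y) (bbv v)).
have E1 : dapp Phi (fun c => nb_lact Psi v x (bmul y c)) = a1 - a2.
  have S1 := dapp_sub Phi P1 P2.
  refine (etrans _ S1); congr dapp; apply/funext => c.
  rewrite nb_lactE (_ : (fun d => v x (bmul (bmul y c) d)) =
                        fun d => v x (bmul y (bmul c d))) //.
  by apply/funext => d; rewrite bmulA.
have E2 : dapp Phi (nb_lact Psi v (bmul x y)) = a3 - a2.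
  have S2 := dapp_sub Phi P3 P2.
  refine (etrans _ S2); congr dapp; apply/funext => c.
  by rewrite nb_lactE bmulA.
by rewrite nb_lactE H1 H2 nb_lactE E1 E2 opprB addrA subrK.
Qed.

Let rM v Phi Psi : nb_ract v (bmul Phi Psi) = nb_ract (nb_ract v Phi) Psi.
Proof.
apply: null_bilinP => x y; rewrite !nb_ractE dapp_arens//.
(* The first Arens product applies [Phi] outermost, the iterated right action [Psi]; the interchange
   reconciles them. *)
rewrite (sw (bilin_mul (bl_l v x y))); congr dapp; apply/funext => c.
rewrite nb_ractE; congr dapp; apply/funext => d.
by rewrite bmulA.
Qed.

Let lrA Phi v Psi : nb_lact Phi (nb_ract v Psi) = nb_ract (nb_lact Phi v) Psi.
Proof.
apply: null_bilinP => x y; rewrite nb_lactE nb_ractE.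
rewrite [RHS](@dapp_sub _ _ Psi
  (fun z => dapp Phi (fun c => v (bmul z x) (bmul y c)))
  (fun z => dapp Phi (v (bmul (bmul z x) y)))); first last.
- exact: bl_comp (bl_comp (bilin_dapp2 Phi (bbv v)) (bl_mulr y)) (bl_mulr x).
- exact: bilin_dapp2 (bilin_comp (bbv v) (bl_mulr x) (bl_mull y)).
congr (_ - _).
  by rewrite (sw (bilin_comp (bbv v) (bl_mulr x) (bl_mull y))).
rewrite -(sw (bilin_comp (bbv v) (bl_mulr (bmul x y)) (@bl_id _ A))).
by congr dapp; apply/funext => c; rewrite bmulA.
Qed.

Let dapp_n Phi (f : A -> K^o) (M : K) (x y : A) : 0 <= M ->
  (forall z, `|f z| <= M * (`|x| * `|y|) * `|z|) ->
  `|dapp Phi f| <= M * `|Phi| * (`|x| * `|y|).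
Proof.
move=> M0 fM; rewrite (mulrC M) -mulrA; apply: dapp_norm => //.
by rewrite !mulr_ge0.
Qed.

Let lb : exists M : K, forall Phi v, `|nb_lact Phi v| <= M * `|Phi| * `|v|.
Proof.
exists 2 => Phi v; apply: null_bilin_norm_le => [|x y].
  by rewrite !mulr_ge0.
rewrite nb_lactE (le_trans (ler_normB _ _))// mulrAC -mulrA.
pose N := `|v| * `|Phi| * (`|x| * `|y|).
rewrite [leRHS](_ : _ = N + N); last by rewrite /N; ring.
rewrite lerD//; apply: dapp_n => // z; apply: le_trans (ler_null_bilin _ _ _) _.
  by rewrite -!mulrA !ler_wpM2l// bmul_norm.
by rewrite -!mulrA ler_wpM2l// mulrA ler_wpM2r// bmul_norm.
Qed.

Let rb : exists M : K, forall v Phi, `|nb_ract v Phi| <= M * `|v| * `|Phi|.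
Proof.
exists 1 => v Phi; rewrite mul1r.
apply: null_bilin_norm_le => [|x y]; first by rewrite !mulr_ge0.
rewrite nb_ractE; apply: dapp_n => // z.
apply: le_trans (ler_null_bilin _ _ _) _.
by rewrite -mulrA ler_wpM2l// mulrAC ler_wpM2r// mulrC bmul_norm.
Qed.

HB.instance Definition _ := isBanachBimodule.Build K (dual (dual A)) V
  lDl lDr lZl lZr rDl rDr rZl rZr lM rM lrA lb rb.

Lemma null_bilin_lactE Phi v x y : lact Phi v x y =
  dapp Phi (fun z => v x (bmul y z)) - dapp Phi (v (bmul x y)).
Proof. by []. Qed.

Lemma null_bilin_ractE Phi v x y :
  ract v Phi x y = dapp Phi (fun z => v (bmul z x) y).
Proof. by []. Qed.

Lemma null_bilin_unital v : lact e v = v /\ ract v e = v.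
Proof.
split; apply: null_bilinP => x y.
  rewrite null_bilin_lactE v0 subr0.
  exact: dapp_identity_mull y eid (bilin_bl2 x (bbv v)).
by rewrite null_bilin_ractE (dapp_identity_mulr x eid (bilin_bl1 y (bbv v))).
Qed.

End NullBilinBimodule.

(** * The canonical derivation *)

Section DualActions.
Variables (R : realType) (A : banachAlgType R[i]) (E : banachBimodType A).
Implicit Types (a : A) (phi : dual E) (x : E).

Lemma dual_lactE a phi x : (lact a phi : dual E) x = phi (ract x a).
Proof. by []. Qed.

Lemma dual_ractE phi a x : (ract phi a : dual E) x = phi (lact a x).
Proof. by []. Qed.

End DualActions.

Section CanonicalDerivation.
Variables (R : realType).
Local Notation K := R[i].
Variables (A : banachAlgType K) (e : dual (dual A)).
Variables (sw : swappable A) (eid : is_identity e).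
Implicit Types (Phi Psi : dual (dual A)).
Local Notation V := (null_bilin_bimod sw eid).
Implicit Types v w : V.

Let bbv v : bounded_bilinear v := null_bilin_bounded v.

Let g v y := dapp e (v^~ y).

Let bl_g v : bounded_linear (g v).
Proof. exact: bilin_dapp1 e (bbv v). Qed.

(** This is Phi . (e (x) e) - (e (x) e) . Phi: the first term is Phi_x e_y v(x, y), which is zero on
    null forms, and the second is Phi_y e_x v(x, y). *)
Lemma canonical_derivation_subproof Phi :
  bounded_linear (fun v : V => - dapp Phi (fun y => dapp e (v^~ y)) : K^o).
Proof.
split=> [k v w|].
  have E y : dapp e ((k *: v + w)^~ y) = k * g v y + g w y.
    exact: (dapp_lin e k (bilin_bl1 y (bbv v)) (bilin_bl1 y (bbv w))).
  rewrite (_ : (fun y => _) = fun y => k * g v y + g w y); last exact/funext.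
  by rewrite (dapp_lin Phi k (bl_g v) (bl_g w)) opprD -mulrN.
exists (`|Phi| * `|e|) => v; rewrite normrN -mulrA; apply: dapp_norm.
  by rewrite mulr_ge0.
move=> y; rewrite -mulrA; apply: dapp_norm; first by rewrite mulr_ge0.
by move=> x; rewrite -mulrA (mulrC `|y|); exact: ler_null_bilin.
Qed.

Definition canonical_derivation Phi : dual V :=
  mk_dual (canonical_derivation_subproof Phi).

Lemma canonical_derivationE Phi v :
  canonical_derivation Phi v = - dapp Phi (fun y => dapp e (v^~ y)).
Proof. by []. Qed.

(** Once [Phi] is moved outside, [e] is absorbed as a right identity. The result is the value at [v]
    of the left action of [Phi] on the derivation at [Psi]. *)
Lemma canonical_derivation_ract Phi Psi v :
  canonical_derivation Psi (ract v Phi) = - dapp Phi (fun x => dapp Psi (v x)).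
Proof.
rewrite canonical_derivationE (sw (bbv v)); congr (- dapp _ _).
apply/funext => y.
apply: etrans (dapp_identityr Phi eid (bilin_bl1 y (bbv v))).
by rewrite (sw (bilin_mul (bilin_bl1 y (bbv v)))).
Qed.

(** The main term of the left action produces the Arens product after an interchange; its
    normalisation produces the extra summand, which cancels [canonical_derivation_ract] in the
    Leibniz rule. *)
Lemma canonical_derivation_lact Phi Psi v :
  canonical_derivation Phi (lact Psi v) =
  canonical_derivation (bmul Phi Psi) v + dapp Phi (fun x => dapp Psi (v x)).
Proof.
rewrite !canonical_derivationE (dapp_arens _ _ (bl_g v)).
apply: oppr_inj; rewrite opprD !opprK.
have P0 := bilin_dapp2 Psi (bilin_mul (bl_g v)).
rewrite -(dapp_sub Phi P0 (bilin_dapp2 Psi (bbv v))).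
congr dapp; apply/funext => y.
have P1 := bilin_comp (bbv v) (@bl_id _ A) (bl_mull y).
have P2 := bilin_dapp2 Psi (bbv v).
apply: etrans (dapp_sub e (bilin_dapp2 Psi P1) (bl_comp P2 (bl_mulr y))) _.
by rewrite (sw P1) (dapp_identity_mulr y eid P2).
Qed.

Lemma canonical_derivationP : derivation canonical_derivation.
Proof.
split; last first.
  move=> Phi Psi; apply: dualP => v.
  rewrite dual_add dual_lactE dual_ractE.
  by rewrite canonical_derivation_ract canonical_derivation_lact addrC addrK.
split=> [k Phi Psi|].
  apply: dualP => v; rewrite dual_add dual_scale !canonical_derivationE.
  by rewrite dapp_linl opprD mulrN.
exists `|e| => Phi; apply: dual_norm_le; first by rewrite mulr_ge0.
move=> v; rewrite canonical_derivationE normrN mulrAC mulrC; apply: dapp_norm.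
  by rewrite mulr_ge0.
move=> y; rewrite -mulrA; apply: dapp_norm; first by rewrite mulr_ge0.
by move=> x; rewrite -mulrA (mulrC `|y|); exact: ler_null_bilin.
Qed.

Lemma canonical_derivation_wstar_continuous :
  wstar_continuous (bidual_predual A) canonical_derivation.
Proof.
apply: wstar_continuous_pointwise => v; exists (fun y => - g v y).
  exact: bl_opp.
by move=> Phi; rewrite (dapp_opp Phi (bl_g v)).
Qed.

Lemma canonical_derivation_wstar_element Phi :
  wstar_element (bidual_predual A) (canonical_derivation Phi).
Proof.
split; apply: wstar_continuous_pointwise => v.
  have P := bilin_dapp2 Phi (bbv v).
  exists (fun x => - dapp Phi (v x)); first exact: bl_opp.
  by move=> Psi; rewrite (dapp_opp Psi P); exact: canonical_derivation_ract.
(* Here [Psi] sits inside [Phi]; interchanging both terms puts it outermost and exhibits the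
   functional on [A] to which it is applied. *)
have P1 := bilin_dapp1 Phi (bilin_mul (bl_g v)).
have P2 := bilin_dapp1 Phi (bbv v).
exists (fun y => - (dapp Phi (fun x => g v (bmul x y)) - dapp Phi (v^~ y))).
  by apply/bl_opp/bl_sub.
move=> Psi; rewrite (dapp_opp Psi (bl_sub P1 P2)) (dapp_sub Psi P1 P2).
rewrite -(sw (bilin_mul (bl_g v))) -(sw (bbv v)) -(dapp_arens _ _ (bl_g v)).
by rewrite opprB addrC; exact: canonical_derivation_lact.
Qed.

End CanonicalDerivation.

(** * Derivations into dual bimodules *)

Section NullPart.
Variables (R : realType).
Local Notation K := R[i].
Variables (A : banachAlgType K) (e : dual (dual A)) (eid : is_identity e).
Variables (b : A -> A -> K^o) (bb : bounded_bilinear b).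

Lemma null_part_subproof x :
  dapp e (fun y => b x y - dapp e (b (bmul x y)) : K^o) = 0.
Proof.
rewrite (dapp_sub e (bilin_bl2 x bb) (bilin_bl2 x (bilin_dapp_mul e bb))).
by rewrite (dapp_identity_mull x eid (bilin_dapp2 e bb)) subrr.
Qed.

(** The null representative of the class of [b]: the form f(xy) with f(x) = e_y b(x, y) is
    subtracted. *)
Definition null_part : null_bilin e :=
  mk_null_bilin (bilin_sub bb (bilin_dapp_mul e bb)) null_part_subproof.

Lemma null_partE x y : null_part x y = b x y - dapp e (b (bmul x y)).
Proof. by []. Qed.

End NullPart.

Section InnerDerivation.
Variables (R : realType).
Local Notation K := R[i].
Variables (A : banachAlgType K) (e : dual (dual A)).
Variables (sw : swappable A) (eid : is_identity e).
Local Notation V := (null_bilin_bimod sw eid).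
Variable N : dual V.
Hypothesis NP : forall Phi,
  canonical_derivation sw eid Phi = lact Phi N - ract N Phi.
Variables (E : banachBimodType A) (D : A -> dual E).
Hypothesis DP : derivation D.
Implicit Types (x : E) (a b c : A).

(** The pairing <x, a . D b>, the form on which the virtual diagonal is evaluated. *)
Definition deriv_form x a b : K^o := D b (ract x a).
Local Notation B := deriv_form.

Lemma deriv_form_bound : exists2 M : K, 0 <= M &
  forall x a b, `|B x a b| <= M * `|x| * (`|a| * `|b|).
Proof.
have [M M0 DM] := ge0_bound DP.1.2.
have [L LP] := @ract_bounded _ _ E.
exists (M * `|L|) => [|x a b]; first by rewrite mulr_ge0.
apply: le_trans (ler_dual _ _) _.
rewrite (_ : _ * _ * _ = M * `|b| * (`|L| * (`|x| * `|a|))); last by ring.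
apply: ler_pM => //; first exact: DM.
by apply: ler_absM; rewrite ?mulr_ge0// mulrA.
Qed.

Lemma deriv_form_bilin x : bounded_bilinear (B x).
Proof.
split=> [a k b c|b k a c|].
- by rewrite /B DP.1.1.
- by rewrite /B ractDr ractZr dual_lin.
have [M M0 BM] := deriv_form_bound.
by exists (M * `|x|).
Qed.
Local Notation bb := deriv_form_bilin.

Lemma deriv_form_lin k x y a b : B (k *: x + y) a b = k * B x a b + B y a b.
Proof. by rewrite /B ractDl ractZl dual_lin. Qed.

Lemma deriv_form_ract x c a b : B (ract x c) a b = B x (bmul c a) b.
Proof. by rewrite /B ractM. Qed.

Lemma deriv_lact x c a : D a (lact c x) = D (bmul a c) x - B x a c.
Proof. by rewrite DP.2 dual_add addrC addrA addNr add0r. Qed.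

(** The Leibniz rule at [x . a]. The second term depends only on the product of [a] and [b], so
    modulo such forms x |-> [B x] respects the left action. *)
Lemma deriv_form_lact x c a b :
  B (lact c x) a b = B x a (bmul b c) - B x (bmul a b) c.
Proof. by rewrite /B -lractA deriv_lact /B ractM. Qed.

Definition null_deriv_form x : V := null_part eid (bb x).
Local Notation Q := null_deriv_form.

Lemma null_deriv_form_ract x c : Q (ract x c) = ract (Q x) (evaluation c).
Proof.
apply: null_bilinP => a b; rewrite null_bilin_ractE dapp_evaluation; last first.
  exact: bl_comp (bilin_bl1 b (null_bilin_bounded (Q x))) (bl_mulr a).
rewrite !null_partE deriv_form_ract; congr (_ - dapp e _); apply/funext => d.
by rewrite deriv_form_ract bmulA.
Qed.

(** Absorbing [e] turns both terms of [deriv_form_lact] into B x a c, so this form is already a null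
    representative. *)
Lemma deriv_form_lact_null x c a : dapp e (B (lact c x) a) = 0.
Proof.
have P1 := bl_comp (bilin_bl2 a (bb x)) (bl_mulr c).
have P2 := bl_comp (bilin_bl1 c (bb x)) (bl_mull a).
rewrite (_ : B _ _ = fun b => B x a (bmul b c) - B x (bmul a b) c); last first.
  by apply/funext => b; exact: deriv_form_lact.
rewrite (dapp_sub e P1 P2) (dapp_identity_mulr c eid (bilin_bl2 a (bb x))).
by rewrite (dapp_identity_mull a eid (bilin_bl1 c (bb x))) subrr.
Qed.

(** The form on the left is its own representative; on the right the two normalising terms of [Q x]
    cancel by associativity. *)
Lemma null_deriv_form_lact x c : Q (lact c x) = lact (evaluation c) (Q x).
Proof.
have bq := null_bilin_bounded (Q x).
apply: null_bilinP => a b; rewrite null_bilin_lactE.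
rewrite (dapp_evaluation _ (bl_comp (bilin_bl2 a bq) (bl_mull b))).
rewrite (dapp_evaluation _ (bilin_bl2 (bmul a b) bq)) !null_partE.
by rewrite deriv_form_lact_null subr0 deriv_form_lact bmulA opprB addrA subrK.
Qed.

Lemma dapp_deriv_form_lin k x y a :
  dapp e (B (k *: x + y) a) = k * dapp e (B x a) + dapp e (B y a).
Proof.
rewrite -(dapp_lin e k (bilin_bl2 a (bb x)) (bilin_bl2 a (bb y))).
by congr dapp; apply/funext => b; exact: deriv_form_lin.
Qed.

Lemma null_deriv_form_lin k x y : Q (k *: x + y) = k *: Q x + Q y.
Proof.
apply: null_bilinP => a b; rewrite null_bilin_add null_bilin_scale !null_partE.
by rewrite deriv_form_lin dapp_deriv_form_lin mulrBr opprD addrACA.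
Qed.

(** The virtual diagonal e (x) e - N applied to [B x], where [N] is evaluated on the null
    representative. *)
Lemma implementing_functional_subproof :
  bounded_linear (fun x => dapp e (fun a => dapp e (B x a)) - N (Q x) : K^o).
Proof.
split=> [k x y|].
  rewrite null_deriv_form_lin dual_lin.
  rewrite (_ : (fun a => _) = fun a => k * dapp e (B x a) + dapp e (B y a)).
    rewrite (dapp_lin e k (bilin_dapp2 e (bb x)) (bilin_dapp2 e (bb y))).
    by rewrite /GRing.scale /= mulrBr opprD addrACA.
  by apply/funext => a; exact: dapp_deriv_form_lin.
have [M M0 BM] := deriv_form_bound.
exists (`|e| * `|e| * M + `|N| * (M + `|e| * M)) => x.
have Be a : `|dapp e (B x a)| <= `|e| * (M * `|x|) * `|a|.
  rewrite -mulrA; apply: dapp_norm => [|b]; first by rewrite !mulr_ge0.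
  by rewrite -mulrA.
rewrite (le_trans (ler_normB _ _))// mulrDl lerD//.
  rewrite -!mulrA; apply: dapp_norm => //; first by rewrite !mulr_ge0.
rewrite (le_trans (ler_dual _ _))// -mulrA ler_wpM2l//.
apply: null_bilin_norm_le => [|a b].
  by rewrite mulr_ge0// addr_ge0// mulr_ge0.
rewrite null_partE (le_trans (ler_normB _ _))// !mulrDl lerD//; first exact: BM.
apply: le_trans (Be _) _; rewrite -!mulrA !ler_wpM2l//; exact: bmul_norm.
Qed.

(** The right side is the value of e . (D c) at [x]. The e (x) e part contributes e_b B x c b, which
    the commutator of [N] cancels, leaving e_a B x a c. *)
Lemma implementing_functional : exists phi : dual E, forall c x,
  phi (ract x c) - phi (lact c x) = dapp e (fun a => D c (ract x a)).
Proof.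
exists (mk_dual implementing_functional_subproof) => c x /=.
have E1 : dapp e (fun a => dapp e (B (ract x c) a)) = dapp e (B x c).
  rewrite -(dapp_identity_mull c eid (bilin_dapp2 e (bb x))).
  congr dapp; apply/funext => a; congr dapp; apply/funext => b.
  exact: deriv_form_ract.
have E2 : dapp e (fun a => dapp e (B (lact c x) a)) = 0.
  by rewrite (_ : (fun a => _) = fun=> 0) ?dapp_cst0//;
     apply/funext => a; exact: deriv_form_lact_null.
(* [Q] intertwines the actions of [c] and its evaluation, so this is the canonical derivation at
   that evaluation, applied to [Q x]. *)
have E3 : N (Q (ract x c)) - N (Q (lact c x)) =
    dapp e (B x c) - dapp e (B x ^~ c).
  rewrite null_deriv_form_ract null_deriv_form_lact.
  have := congr1 (fun f : dual V => f (Q x)) (NP (evaluation c)).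
  rewrite dual_add dual_opp dual_lactE dual_ractE => <-.
  rewrite canonical_derivationE.
  rewrite (dapp_evaluation _ (bilin_dapp1 e (null_bilin_bounded (Q x)))).
  rewrite -opprB; congr (- _).
  rewrite -[X in _ - X](dapp_identity_mulr c eid (bilin_dapp2 e (bb x))).
  have P := bl_comp (bilin_dapp2 e (bb x)) (bl_mulr c).
  exact: (dapp_sub e (bilin_bl1 c (bb x)) P).
rewrite E1 E2 sub0r opprK -addrA [- _ + _]addrC -opprB E3 opprB.
by rewrite addrC subrK.
Qed.

(** * The remaining derivation D - e . D *)

Lemma bl_deriv_eval x : bounded_linear (fun a => D a x : K^o).
Proof. exact: bl_comp (dual_bounded_linear (evaluation x)) DP.1. Qed.

Definition deriv_defect x a : K^o := D a x - dapp e (B x ^~ a).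

Lemma bl_deriv_defect x : bounded_linear (deriv_defect x).
Proof. exact: bl_sub (bl_deriv_eval x) (bilin_dapp1 e (bb x)). Qed.

(** Leibniz without its first term: writing D' for D - e . D, it says D'(a) . c = D'(ac). *)
Lemma deriv_defect_lact x c a :
  deriv_defect (lact c x) a = deriv_defect x (bmul a c).
Proof.
have P1 := bilin_bl1 (bmul a c) (bb x).
have P2 := bl_comp (bilin_bl1 c (bb x)) (bl_mulr a).
rewrite /deriv_defect deriv_lact.
rewrite (_ : (B (lact c x))^~ a =
             fun b => B x b (bmul a c) - B x (bmul b a) c); last first.
  by apply/funext => b; exact: deriv_form_lact.
rewrite (dapp_sub e P1 P2) (dapp_identity_mulr a eid (bilin_bl1 c (bb x))).
by rewrite opprB addrA subrK.
Qed.

(** Left multiplication kills the defect, since [e] acts as a right identity: e_b B x (cb) a = B x c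
    a. *)
Lemma deriv_defect_ract x c a : deriv_defect (ract x c) a = 0.
Proof.
rewrite /deriv_defect -[D a _]/(B x c a).
rewrite -(dapp_identity_mull c eid (bilin_bl1 a (bb x))).
rewrite (_ : (B (ract x c))^~ a = fun b => B x (bmul c b) a) ?subrr//.
by apply/funext => b; exact: deriv_form_ract.
Qed.

Lemma defect_functional_subproof :
  bounded_linear (fun x => - dapp e (deriv_defect x) : K^o).
Proof.
split=> [k x y|].
  have P u := bl_deriv_defect u.
  rewrite (_ : deriv_defect _ =
               fun a => k * deriv_defect x a + deriv_defect y a).
    by rewrite (dapp_lin e k (P x) (P y)) opprD -mulrN.
  apply/funext => a; rewrite /deriv_defect dual_lin.
  rewrite (_ : (fun b => B _ b a) = fun b => k * B x b a + B y b a).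
    rewrite (dapp_lin e k (bilin_bl1 a (bb x)) (bilin_bl1 a (bb y))).
    by rewrite mulrBr opprD addrACA.
  by apply/funext => b; exact: deriv_form_lin.
have [M M0 BM] := deriv_form_bound; have [L L0 DL] := ge0_bound DP.1.2.
exists (`|e| * (L + `|e| * M)) => x; rewrite normrN -mulrA.
apply: dapp_norm => [|a]; first by rewrite mulr_ge0// addr_ge0// mulr_ge0.
rewrite (le_trans (ler_normB _ _))// !mulrDl lerD//.
  by rewrite mulrAC (le_trans (ler_dual _ _))// ler_wpM2r//; exact: DL.
rewrite -!mulrA; apply: dapp_norm => [|b]; first by rewrite !mulr_ge0.
by rewrite -!mulrA (mulrC `|a|) mulrA; exact: BM.
Qed.

(** For psi = - e_a [deriv_defect x a], the term c . psi vanishes, while - psi . c equals e_a of the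
    defect at ac, where [e] is absorbed. *)
Lemma defect_functional : exists psi : dual E, forall c x,
  psi (ract x c) - psi (lact c x) = deriv_defect x c.
Proof.
exists (mk_dual defect_functional_subproof) => c x /=.
rewrite opprK (_ : deriv_defect (ract x c) = fun=> 0); last first.
  by apply/funext => a; exact: deriv_defect_ract.
rewrite dapp_cst0 oppr0 add0r.
rewrite -[RHS](dapp_identity_mulr c eid (bl_deriv_defect x)).
by congr dapp; apply/funext => a; exact: deriv_defect_lact.
Qed.

(** [phi] implements e . D and [psi] implements D - e . D, so their sum implements [D]. *)
Lemma derivation_inner : inner D.
Proof.
have [phi phiP] := implementing_functional.
have [psi psiP] := defect_functional.
exists (phi + psi) => c; apply: dualP => x.
rewrite dual_add dual_opp dual_lactE dual_ractE !dual_add opprD addrACA.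
by rewrite phiP psiP /deriv_defect addrC subrK.
Qed.

End InnerDerivation.

Theorem theorem4p8 (R : realType) (A : banachAlgType R[i])
  (wc : forall T : A -> dual A, bounded_linear T -> weakly_compact T)
  (sca : strongly_connes_amenable (dual (dual A)) (bidual_predual A)) :
  amenable A.
Proof.
move=> E D DP; have sw := weakly_compact_swappable wc.
have [e eid innerP] := sca.
have [N NP] := innerP _ (@null_bilin_unital _ _ _ sw eid) _
  (canonical_derivationP sw eid)
  (@canonical_derivation_wstar_continuous _ _ _ sw eid)
  (@canonical_derivation_wstar_element _ _ _ sw eid).
exact: derivation_inner NP _ _ DP.
Qed.
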